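(* Let $C\colon y^2=f(x)$ be a hyperelliptic curve over $K$ and $(\Sigma,\mathcal R,d)$ its cluster picture, with the natural $G_K$-action. (1) If $f(x)\in\mathcal O_K[x]$ then $(\Sigma,v(c_f))$ is integral. (2) Conversely, if $(\Sigma,v(c_f))$ is integral and $G_K$ acts tamely on $\mathcal R$, then $f(x-z)\in\mathcal O_K[x]$ for some $z\in K$.
   Context: $K$ is a non-archimedean local field with ring of integers $\mathcal O_K$, finite residue field of characteristic $p\ne2$, valuation $v$ on $\bar K$ with $v(\pi)=1$ for a uniformiser $\pi$, $G_K$ the absolute Galois group. $C\colon y^2=f(x)$, $f\in K[x]$ separable of degree $2g+1$ or $2g+2$, $g\ge2$, leading coefficient $c_f$, roots $\mathcal R\subset\bar K$. Its cluster picture $\Sigma$ is the set of clusters: non-empty subsets $D\cap\mathcal R$ for discs $D=\{x\in\bar K:v(x-z)\ge d\}$; a cluster of size $>1$ (proper) has depth $d_{\mathfrak s}=\min_{r,r'\in\mathfrak s}v(r-r')$; a child of $\mathfrak s$ is a maximal cluster strictly contained in $\mathfrak s$; $r\wedge\mathfrak s$ is the smallest cluster containing $r$ and $\mathfrak s$. $G_K$ acts on clusters through $\mathcal R$. For $n\in\mathbb Z$, the pair $(\Sigma,n)$ is integral if either $n\ge0$ and $d_{\mathcal R}\ge0$, or there is a $G_K$-stable proper cluster $\mathfrak s$ with $d_{\mathfrak s}\le0$ and $n+(|\mathfrak s|-|\mathfrak t|)d_{\mathfrak s}+\sum_{r\notin\mathfrak s}d_{r\wedge\mathfrak s}\ge0$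 for some $\mathfrak t$ which is either empty or a $G_K$-stable child $\mathfrak t<\mathfrak s$ with either $|\mathfrak t|=1$ or $d_{\mathfrak t}\ge0$. *)

(* Defs.v *)
From HB Require Import structures.
From mathcomp Require Import all_boot all_order all_algebra all_field.
From mathcomp Require Import finmap.
From Stdlib Require Import ClassicalEpsilon.
Set Implicit Arguments. Unset Strict Implicit. Unset Printing Implicit Defensive.
Import Order.TTheory GRing.Theory Num.Theory.
Local Open Scope ring_scope.


Section Setting.
(* L plays the role of \bar K, K is a subfield of L given as a predicate,
   v : L -> Q is the valuation on \bar K (v 0 is irrelevant; 0 has valuation +oo,
   encoded through [vge]/[vgt]). *)
Variable L : closedFieldType.
Variable K : {pred L}.
Variable v : L -> rat.

Definition vge (x : L) (d : rat) : bool := (x == 0) || (d <= v x).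
Definition vgt (x : L) (d : rat) : bool := (x == 0) || (d < v x).

Definition is_valuation : Prop :=
  (forall x y : L, x != 0 -> y != 0 -> v (x * y) = v x + v y) /\
  (forall x y : L, x != 0 -> y != 0 -> x + y != 0 ->
     Num.min (v x) (v y) <= v (x + y)).

Definition OK : {pred L} := fun x => (x \in K) && vge x 0.

Definition Kcauchy (u : nat -> L) : Prop :=
  forall N : nat, exists M : nat, forall m n : nat, (M <= m)%N -> (M <= n)%N ->
    vge (u m - u n) N%:R.

Definition Kconverges (u : nat -> L) (l : L) : Prop :=
  forall N : nat, exists M : nat, forall n : nat, (M <= n)%N -> vge (u n - l) N%:R.

Definition K_algebraic_closure : Prop :=
  forall x : L, exists p : {poly L}, [/\ p != 0, p \is a polyOver K & root p x].

Definition v_discrete_normalised : Prop :=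
  (exists pi, pi \in K /\ v pi = 1) /\
  (forall x, x \in K -> x != 0 -> exists n : int, v x = n%:~R).

Definition K_complete : Prop :=
  forall u : nat -> L, (forall n, u n \in K) -> Kcauchy u ->
    exists2 l, l \in K & Kconverges u l.

Definition finite_residue_field : Prop :=
  exists reps : seq L, all (fun a => a \in OK) reps /\
    forall x, x \in OK -> exists2 a, a \in reps & vgt (x - a) 0.

Definition residue_char_not_2 : Prop := (2%:R : L) != 0 /\ v 2%:R = 0.

(* K is a non-archimedean local field with residue characteristic p <> 2,
   L (algebraically closed by its type) is an algebraic closure of K, and v is
   a valuation on L, discrete on K and normalised so that v(pi) = 1 for a
   uniformiser pi of K. *)
Definition local_field_setting : Prop :=
  [/\ divring_closed K, K_algebraic_closure, is_valuation,
      v_discrete_normalised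
    & [/\ K_complete, finite_residue_field & residue_char_not_2]].

Definition GK (s : L -> L) : Prop :=
  [/\ forall x y, s (x + y) = s x + s y,
      forall x y, s (x * y) = s x * s y,
      s 1 = 1,
      bijective s
    & forall k, k \in K -> s k = k].

(* wild inertia subgroup: sigma with v(sigma(x)/x - 1) > 0 for all x <> 0 *)
Definition wild_inertia (s : L -> L) : Prop :=
  GK s /\ forall x : L, x != 0 -> vgt (s x - x) (v x).

Variable R : {fset L}.

Definition tame_on_R : Prop :=
  forall s, wild_inertia s -> forall r, r \in R -> s r = r.

Definition in_disc (z : L) (d : rat) (x : L) : bool := vge (x - z) d.

Definition is_cluster (s : {fset L}) : Prop :=
  s != fset0 /\ exists (z : L) (d : rat), s = [fset x in R | in_disc z d x]%fset.

Definition proper (s : {fset L}) : bool := (1 < #|` s|)%N.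

(* depth: minimum of v(r - r') over distinct r, r' in s (meaningful for proper s) *)
Definition depth (s : {fset L}) : rat :=
  let vs := [seq v (p.1 - p.2) | p <- [seq (x, y) | x <- enum_fset s, y <- enum_fset s]
                               & p.1 != p.2] in
  foldr Num.min (head 0 vs) vs.

Definition child (t s : {fset L}) : Prop :=
  [/\ is_cluster t, (t `<` s)%fset &
      forall c, is_cluster c -> (t `<` c)%fset -> (c `<=` s)%fset -> c = s].

Definition wedge (r : L) (s : {fset L}) : {fset L} :=
  epsilon (inhabits fset0) (fun c => [/\ is_cluster c, r \in c, (s `<=` c)%fset &
     forall c', is_cluster c' -> r \in c' -> (s `<=` c')%fset -> (c `<=` c')%fset]).

Definition stable (s : {fset L}) : Prop :=
  forall sg, GK sg -> [fset sg x | x in s]%fset = s.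

Definition integral (n : int) : Prop :=
  ((0 <= n)%R /\ 0 <= depth R) \/
  exists s : {fset L},
    [/\ is_cluster s, proper s, stable s, depth s <= 0 &
      exists t : {fset L},
        (t = fset0 \/ [/\ child t s, stable t & (#|` t| = 1%N \/ 0 <= depth t)]) /\
        0 <= n%:~R + ((#|` s|)%:R - (#|` t|)%:R) * depth s
             + \sum_(r <- enum_fset R | r \notin s) depth (wedge r s)].

End Setting.

(* Main.v *)
Require Import Defs.
From HB Require Import structures.
From mathcomp Require Import all_boot all_order all_algebra all_field.
From mathcomp Require Import finmap.
From mathcomp Require Import lra ring zify.
From mathcomp Require boolp classical_sets.
From Stdlib Require Import ClassicalEpsilon.
Set Implicit Arguments. Unset Strict Implicit. Unset Printing Implicit Defensive.
Import Order.TTheory GRing.Theory Num.Theory.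
Local Open Scope ring_scope.

(* By Gauss, [f (x + z)] is integral iff [v c_f + \sum_r min (v (r - z)) 0 >= 0].
   For (1), apply this with [z = 0]: the discs [v x >= d] are Galois stable, and
   the smallest one with [d <= 0] that meets [R] serves as [s] with [t] empty if its
   depth is negative, and otherwise as [t], with the next larger one as [s]; the
   depths in the integrality condition bound [min (v r) 0] from above.
   For (2), take [z] rational in the disc of [t] (or of [s]); the terms of the
   integrality condition then bound [min (v (r - z)) 0] from below.

   Such a [z] exists because a stable disc containing a tame root [r] has a
   rational point.  An automorphism fixing all [e]-th roots of [pi], for all [e]
   prime to the residue characteristic, is wild, so [r] is determined by the
   [e]-th roots of [pi] for a single [e]; averaging the conjugates of [r] with
   suitable roots of unity as weights then gives a point of [K].
   Automorphisms are extended by Zorn's lemma, and they preserve [v] because all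
   norms on a finite-dimensional space over the complete field [K] are equivalent. *)

(** * Valuations *)

(** The weights in the averaging are forced. The number of conjugates includes the degree of a root
    of unity over [K], which the residue characteristic [p] may divide even though [e] is prime to
    [p]; dividing by this number could then push the mean out of the disc. Some total weight is
    always a unit, so dividing by it is harmless. Wildness of an automorphism fixing the roots of
    [pi] rests on two finiteness facts: every value of [v] is a rational multiple of [v pi], and the
    residue field of [L] is algebraic over a finite field, so each unit has a power congruent to 1.
    Invariance of [v] enters here, and again when discs around 0 are shown to be stable. Elements of
    [GK] are plain functions on [L], so Galois descent is proved from scratch: conjugate elements
    are joined by an automorphism of all of [L], and an invariant element of a field generated by
    separable elements lies in the base. Separability is tracked throughout because [K] may have
    characteristic [p]; the roots of [f], the [e]-th roots of unity and those of [pi] all satisfy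
    it. *)

Section Valuation.
Variables (L : closedFieldType) (v : L -> rat).
Hypothesis hv : is_valuation v.

Lemma valM x y : x != 0 -> y != 0 -> v (x * y) = v x + v y.
Proof. exact: hv.1. Qed.

Lemma val1 : v 1 = 0.
Proof.
have := valM (oner_neq0 L) (oner_neq0 L); rewrite mulr1 => /eqP.
by rewrite -subr_eq subrr eq_sym => /eqP.
Qed.

Lemma valN1 : v (-1) = 0.
Proof.
have n0 : -1 != 0 :> L by rewrite oppr_eq0 oner_neq0.
have := valM n0 n0; rewrite mulrNN mulr1 val1; lra.
Qed.

Lemma valN x : x != 0 -> v (- x) = v x.
Proof. by move=> x0; rewrite -mulN1r valM ?oppr_eq0 ?oner_neq0// valN1 add0r. Qed.

Lemma valX x n : x != 0 -> v (x ^+ n) = n%:R * v x.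
Proof.
move=> x0; elim: n => [|n IH]; first by rewrite expr0 val1 mul0r.
by rewrite exprS valM ?expf_neq0// IH -natr1 mulrDl mul1r addrC.
Qed.

Lemma valV x : x != 0 -> v x^-1 = - v x.
Proof.
move=> x0; have := valM x0 (invr_neq0 x0); rewrite divff// val1; lra.
Qed.

Lemma vge0 d : vge v 0 d. Proof. by rewrite /vge eqxx. Qed.
Lemma vgt0 d : vgt v 0 d. Proof. by rewrite /vgt eqxx. Qed.

Lemma vge_refl x : vge v x (v x). Proof. by rewrite /vge lexx orbT. Qed.

Lemma vgeE x d : x != 0 -> vge v x d = (d <= v x).
Proof. by rewrite /vge => /negPf ->. Qed.

Lemma vgtE x d : x != 0 -> vgt v x d = (d < v x).
Proof. by rewrite /vgt => /negPf ->. Qed.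

Lemma vge_le x a b : a <= b -> vge v x b -> vge v x a.
Proof. by move=> ab; rewrite /vge; case: eqP => //= _; apply: le_trans. Qed.

Lemma vgt_vge x a : vgt v x a -> vge v x a.
Proof. by rewrite /vgt /vge; case: eqP => //= _; apply: ltW. Qed.

Lemma vge_vgt x a b : a < b -> vge v x b -> vgt v x a.
Proof. by move=> ab; rewrite /vgt /vge; case: eqP => //= _; apply: lt_le_trans. Qed.

Lemma vgeP x d : vge v x d -> vgt v x d \/ x != 0 /\ v x = d.
Proof.
rewrite /vge /vgt; case: eqP => //= _; first by left.
by rewrite le_eqVlt => /orP[/eqP ->|]; [right|left].
Qed.

Lemma vgeN x d : vge v (- x) d = vge v x d.
Proof. by rewrite /vge oppr_eq0; case: (eqVneq x 0) => //= x0; rewrite valN. Qed.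

Lemma vgtN x d : vgt v (- x) d = vgt v x d.
Proof. by rewrite /vgt oppr_eq0; case: (eqVneq x 0) => //= x0; rewrite valN. Qed.

Lemma vgeD x y d : vge v x d -> vge v y d -> vge v (x + y) d.
Proof.
rewrite /vge; have [->|x0] := eqVneq x 0; first by rewrite add0r.
have [->|y0] := eqVneq y 0; first by rewrite addr0 (negPf x0).
have [//|xy0] := eqVneq (x + y) 0 => /= dx dy.
by apply: le_trans (hv.2 _ _ x0 y0 xy0); rewrite le_min dx.
Qed.

Lemma vgtD x y d : vgt v x d -> vgt v y d -> vgt v (x + y) d.
Proof.
rewrite /vgt; have [->|x0] := eqVneq x 0; first by rewrite add0r.
have [->|y0] := eqVneq y 0; first by rewrite addr0 (negPf x0).
have [//|xy0] := eqVneq (x + y) 0 => /= dx dy.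
by apply: lt_le_trans (hv.2 _ _ x0 y0 xy0); rewrite lt_min dx.
Qed.

Lemma vgeB x y d : vge v x d -> vge v y d -> vge v (x - y) d.
Proof. by move=> hx hy; apply: vgeD; rewrite ?vgeN. Qed.

Lemma vgtB x y d : vgt v x d -> vgt v y d -> vgt v (x - y) d.
Proof. by move=> hx hy; apply: vgtD; rewrite ?vgtN. Qed.

Lemma vgeM x y a b : vge v x a -> vge v y b -> vge v (x * y) (a + b).
Proof.
rewrite /vge mulf_eq0; case: (eqVneq x 0) => //= x0; case: (eqVneq y 0) => //= y0.
by rewrite valM//; apply: lerD.
Qed.

Lemma vgtM x y a b : vgt v x a -> vge v y b -> vgt v (x * y) (a + b).
Proof.
rewrite /vge /vgt mulf_eq0; case: (eqVneq x 0) => //= x0; case: (eqVneq y 0) => //= y0.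
by rewrite valM//; apply: ltr_leD.
Qed.

Lemma vge_sum (I : Type) (r : seq I) (P : pred I) (F : I -> L) d :
  (forall i, P i -> vge v (F i) d) -> vge v (\sum_(i <- r | P i) F i) d.
Proof.
move=> h; apply: (big_ind (fun x => vge v x d)) => //; [exact: vge0|].
by move=> x y; apply: vgeD.
Qed.

Lemma vgt_sum (I : Type) (r : seq I) (P : pred I) (F : I -> L) d :
  (forall i, P i -> vgt v (F i) d) -> vgt v (\sum_(i <- r | P i) F i) d.
Proof.
move=> h; apply: (big_ind (fun x => vgt v x d)) => //; [exact: vgt0|].
by move=> x y; apply: vgtD.
Qed.

Lemma vgeX x n : vge v x 0 -> vge v (x ^+ n) 0.
Proof.
move=> h; elim: n => [|n IH]; first by rewrite vgeE ?oner_neq0// val1.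
by rewrite exprS -[0 as X in vge v _ X](addr0 0); apply: vgeM.
Qed.

Lemma vge1 : vge v 1 0. Proof. by rewrite vgeE ?oner_neq0// val1. Qed.

Lemma vgt1 : vgt v 1 0 = false. Proof. by rewrite vgtE ?oner_neq0// val1. Qed.

Lemma vge_nat n : vge v n%:R 0.
Proof. by elim: n => [|n IH]; [exact: vge0|rewrite -natr1 vgeD// vge1]. Qed.

Lemma vgeM0 x y : vge v x 0 -> vge v y 0 -> vge v (x * y) 0.
Proof. by move=> hx hy; have := vgeM hx hy; rewrite addr0. Qed.

Lemma vgtM0 x y : vgt v x 0 -> vge v y 0 -> vgt v (x * y) 0.
Proof. by move=> hx hy; have := vgtM hx hy; rewrite addr0. Qed.

Lemma vgtMl0 x y : vge v x 0 -> vgt v y 0 -> vgt v (x * y) 0.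
Proof. by move=> hx hy; rewrite mulrC vgtM0. Qed.

Lemma valD_gt x y : x != 0 -> vgt v y (v x) -> x + y != 0 /\ v (x + y) = v x.
Proof.
move=> x0 hy; have hx : ~~ vgt v x (v x) by rewrite vgtE// ltxx.
have hs : ~~ vgt v (x + y) (v x).
  by apply: contra hx => h; have := vgtB h hy; rewrite addrK.
have [//|[xy0 ->//]] := vgeP (vgeD (vge_refl x) (vgt_vge hy)).
by rewrite (negPf hs).
Qed.

(** The maximal ideal is prime. Later this selects, among the factors [y - z] of [y ^+ e - 1], a
    root of unity [z] congruent to [y]. *)
Lemma vgt_prod (I : eqType) (r : seq I) (F : I -> L) :
  (forall i, i \in r -> vge v (F i) 0) -> vgt v (\prod_(i <- r) F i) 0 ->
  exists2 i, i \in r & vgt v (F i) 0.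
Proof.
elim: r => [|a r IH] h; first by rewrite big_nil vgt1.
rewrite big_cons.
have [ha _|[Fa0 va]] := vgeP (h a (mem_head a r)); first by exists a; rewrite ?mem_head.
rewrite /vgt mulf_eq0 (negPf Fa0) /= => ht.
have [||i ir hi] := IH; last by exists i => //; rewrite inE ir orbT.
- by move=> i ir; apply: h; rewrite inE ir orbT.
rewrite /vgt; case: eqVneq ht => //= p0.
by rewrite valM// va add0r.
Qed.

End Valuation.

(** * Automorphisms of an algebraic closure *)

Section Subfield.
Variables (L : closedFieldType) (T : {pred L}).
Hypothesis hT : divring_closed T.
HB.instance Definition _ := GRing.isDivringClosed.Build L T hT.

(** A predicate carries no polynomial division; as a field type, [T] has it, and [map_modp]
    transports the remainder back to [L]. *)
Definition subfield_of : Type := sig (fun x : L => x \in T).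
HB.instance Definition _ := SubChoice.on subfield_of.
HB.instance Definition _ := [SubChoice_isSubIntegralDomain of subfield_of by <:].
HB.instance Definition _ := [SubIntegralDomain_isSubField of subfield_of by <:].

Lemma polyOver_subfield (p : {poly L}) :
  p \is a polyOver T -> exists q : {poly subfield_of}, p = map_poly val q.
Proof.
move=> /polyOverP hp; exists (\poly_(i < size p) (Sub p`_i (hp i) : subfield_of)).
apply/polyP => i; rewrite coef_map coef_poly; case: ltnP => //= h.
by rewrite nth_default// raddf0.
Qed.

Lemma polyOver_modp (p q : {poly L}) :
  p \is a polyOver T -> q \is a polyOver T -> p %% q \is a polyOver T.
Proof.
move=> /polyOver_subfield[p' ->] /polyOver_subfield[q' ->].
by rewrite -map_modp; apply/polyOverP => i; rewrite coef_map /=; apply: valP.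
Qed.

End Subfield.

Section Extension.
Variables (L : closedFieldType) (K : {pred L}).
Hypotheses (hK : divring_closed K) (hA : K_algebraic_closure K).
HB.instance Definition _ := GRing.isDivringClosed.Build L K hK.

(** Divide a polynomial relation of [x] by its lowest nonzero coefficient. Thanks to this, closure
    under ring operations suffices everywhere below and inverses come for free. *)
Lemma alg_inv (x : L) : x != 0 ->
  exists2 Q : {poly L}, Q \is a polyOver K & x^-1 = Q.[x].
Proof.
move=> x0; have [p [p0 pK]] := hA x.
elim/poly_ind: p p0 pK => [|p c IH]; first by rewrite eqxx.
move=> p0 /polyOverP pK.
have cK : c \in K by have := pK 0; rewrite coefD coefMX coefC add0r.
have qK : p \is a polyOver K.
  by apply/polyOverP => i; have := pK i.+1; rewrite coefD coefMX coefC addr0.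
rewrite rootE hornerD hornerM hornerX hornerC.
have [c0|c0] := eqVneq c 0.
  rewrite c0 addr0 mulf_eq0 (negPf x0) orbF => px; apply: IH => //.
  by apply: contraNneq p0 => ->; rewrite mul0r c0 polyC0 add0r.
rewrite addr_eq0 => /eqP h.
exists ((- c^-1) *: p); first by rewrite polyOverZ// rpredN rpredV.
rewrite hornerZ; apply: (mulIf x0); rewrite mulVf// -mulrA h.
by rewrite mulrNN mulVf.
Qed.

Lemma roots_of (p : {poly L}) : p != 0 ->
  exists s : seq L, uniq s /\ forall z, (z \in s) = root p z.
Proof.
have [s ps] := closed_field_poly_normal p.
move=> p0; exists (undup s); split; first exact: undup_uniq.
by move=> z; rewrite mem_undup ps rootZ ?lead_coef_eq0// root_prod_XsubC.
Qed.

(** The graph of a homomorphism over [K] from a subring of [L]. As a relation it can be enlarged by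
    plain unions, which suits Zorn's lemma; the last clause is single-valuedness at 0, hence
    everywhere by subtraction. *)
Definition partial_aut (G : L * L -> Prop) : Prop :=
  [/\ forall k, k \in K -> G (k, k),
      forall a b, G a -> G b -> G (a - b),
      forall a b, G a -> G b -> G (a * b)
    & forall y, G (0, y) -> y = 0].

Definition poly_rel (G : L * L -> Prop) (h k : {poly L}) : Prop :=
  forall i, G (h`_i, k`_i).

(** The only candidate for an extension of [G] sending [x] to [y]: [k] is [h] with the homomorphism
    applied to its coefficients. *)
Definition adjoin (G : L * L -> Prop) (x y : L) (z : L * L) : Prop :=
  exists h k, poly_rel G h k /\ z = (h.[x], k.[y]).

Section PartialAut.
Variable G : L * L -> Prop.
Hypothesis hG : partial_aut G.

Let GK0 k : k \in K -> G (k, k). Proof. by case: hG => h _ _ _; apply: h. Qed.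
Let GB a b : G a -> G b -> G (a - b). Proof. by case: hG => _ h _ _; apply: h. Qed.
Let GM a b : G a -> G b -> G (a * b). Proof. by case: hG => _ _ h _; apply: h. Qed.
Let Gfun y : G (0, y) -> y = 0. Proof. by case: hG => _ _ _; apply. Qed.
Let G0 : G 0. Proof. exact: (GK0 (rpred0 K)). Qed.
Let GD a b : G a -> G b -> G (a + b).
Proof. by move=> ha hb; rewrite -[b]opprK -[- b]add0r; do 2![apply: GB => //]. Qed.

Lemma partial_aut_inj x y y' : G (x, y) -> G (x, y') -> y = y'.
Proof.
move=> h h'; apply/subr0_eq/Gfun.
suff : G (x - x, y - y') by rewrite subrr.
exact: (GB h h').
Qed.

Let poly_relB h k h' k' : poly_rel G h k -> poly_rel G h' k' ->
  poly_rel G (h - h') (k - k').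
Proof. by move=> H H' i; rewrite !coefB; apply: (GB (H i) (H' i)). Qed.

Let Gsum n (F : 'I_n -> L * L) : (forall i, G (F i)) ->
  G (\sum_i (F i).1, \sum_i (F i).2).
Proof.
move=> h; apply: (big_ind2 (fun a b => G (a, b))) => [|a b a' b' H H'|i _].
- exact: G0.
- exact: GD H H'.
- by have := h i; case: (F i).
Qed.

Let poly_relM h k h' k' : poly_rel G h k -> poly_rel G h' k' ->
  poly_rel G (h * h') (k * k').
Proof.
move=> H H' i; rewrite !coefM.
apply: (Gsum (F := fun j : 'I_i.+1 => (h`_j * h'`_(i - j), k`_j * k'`_(i - j)))).
by move=> j; apply: (GM (H j) (H' _)).
Qed.

Let poly_rel_horner h k a b : poly_rel G h k -> G (a, b) -> G (h.[a], k.[b]).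
Proof.
move=> H Gab; pose n := maxn (size h) (size k).
rewrite (horner_coef_wide a (leq_maxl _ (size k) : (_ <= n)%N)).
rewrite (horner_coef_wide b (leq_maxr (size h) _ : (_ <= n)%N)).
apply: (Gsum (F := fun j : 'I_n => (h`_j * a ^+ j, k`_j * b ^+ j))) => j.
suff hj : G (a ^+ j, b ^+ j) by exact: (GM (H j) hj).
elim: (nat_of_ord j) => [|m IH].
  exact: GK0 (rpred1 K).
by rewrite !exprS; apply: (GM Gab IH).
Qed.

Let poly_relK Q : Q \is a polyOver K -> poly_rel G Q Q.
Proof. by move/polyOverP => h i; apply: GK0. Qed.

Let poly_relC a b : G (a, b) -> poly_rel G a%:P b%:P.
Proof. by move=> h i; rewrite !coefC; case: eqP. Qed.

(** Write the inverse of [a] as [Q.[a]] with [Q] over [K]; then [Q.[b]] is its image, and it inverts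
    [b]. In particular the homomorphism is injective. *)
Lemma partial_autV a b : G (a, b) -> a != 0 -> b != 0 /\ G (a^-1, b^-1).
Proof.
move=> Gab a0; have [Q QK aQ] := alg_inv a0.
have h := poly_rel_horner (poly_relK QK) Gab.
have := GM Gab h; rewrite -aQ => h1.
have bQ : b * Q.[b] = 1.
  apply: (@partial_aut_inj 1); last exact: GK0 (rpred1 K).
  by move: (h1 : G (a / a, b * Q.[b])); rewrite divff.
have b0 : b != 0 by apply: contra_eq_neq bQ => ->; rewrite mul0r eq_sym oner_neq0.
split=> //; move: h; rewrite -aQ; congr (G (_, _)).
by apply: (mulfI b0); rewrite bQ divff.
Qed.

Lemma poly_rel_size h k : poly_rel G h k -> size h = size k.
Proof.
move=> H; have e i : (h`_i == 0) = (k`_i == 0).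
  have [h0|h0] := eqVneq h`_i 0.
    by have := H i; rewrite h0 => /Gfun ->; rewrite eqxx.
  by have [/negPf -> _] := partial_autV (H i) h0.
apply/eqP; rewrite eqn_leq; apply/andP; split; apply/leq_sizeP => j hj; apply/eqP.
  by rewrite e nth_default.
by rewrite -e nth_default.
Qed.

Lemma size_cancel_lead (h p : {poly L}) : p != 0 -> (size p <= size h)%N ->
  (size (h - (lead_coef h / lead_coef p)%:P * 'X^(size h - size p) * p)%R < size h)%N.
Proof.
move=> p0 ph; set m := (size h - size p)%N.
have h0 : h != 0 by rewrite -size_poly_gt0; apply: leq_trans ph; rewrite size_poly_gt0.
have sh : (size h).-1.+1 = size h by rewrite prednK// size_poly_gt0.
have mM : (size h).-1 = ((size p).-1 + m)%N.
  by move: ph; rewrite /m; move: p0 h0; rewrite -!size_poly_gt0; lia.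
rewrite -[X in (_ < X)%N]sh ltnS; apply/leq_sizeP => j.
rewrite leq_eqVlt => /orP[/eqP <-|jh]; rewrite coefB -mulrA coefCM mulrC coefXnM.
  have -> : ((size h).-1 < m)%N = false by rewrite mM; lia.
  rewrite [X in p`_X](_ : _ = (size p).-1); last by rewrite mM; lia.
  by rewrite -!lead_coefE mulrC divfK ?lead_coef_eq0 ?subrr.
have jm : (j < m)%N = false.
  by apply/negbTE; rewrite -leqNgt; apply: leq_trans (ltnW jh); rewrite mM leq_addl.
rewrite [h`_j]nth_default; last by rewrite -sh.
rewrite jm nth_default ?mul0r ?subrr//.
move: jh; rewrite mM -addSn prednK ?size_poly_gt0// => jh.
by rewrite leq_subRL 1?addnC// leqNgt jm.
Qed.

Lemma adjoin_incl x y z : G z -> adjoin G x y z.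
Proof.
case: z => a b h; exists a%:P, b%:P; split; first exact: poly_relC.
by rewrite !hornerC.
Qed.

Lemma adjoin_pt x y : adjoin G x y (x, y).
Proof.
exists 'X, 'X; rewrite !hornerX; split=> //.
by apply: poly_relK; rewrite polyOverX.
Qed.

Lemma adjoin_partial_aut x y :
  (forall h k, poly_rel G h k -> h.[x] = 0 -> k.[y] = 0) ->
  partial_aut (adjoin G x y).
Proof.
move=> hxy; split.
- by move=> k kK; apply/adjoin_incl/GK0.
- move=> _ _ [h [k [H ->]]] [h' [k' [H' ->]]].
  by exists (h - h'), (k - k'); split; [exact: poly_relB|rewrite !hornerE].
- move=> _ _ [h [k [H ->]]] [h' [k' [H' ->]]].
  by exists (h * h'), (k * k'); split; [exact: poly_relM|rewrite !hornerE].
- by move=> _ [h [k [H [h0 ->]]]]; apply: hxy H (esym h0).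
Qed.

(** Take [p] of least size over the domain of [G] vanishing at [x], let [q] be its image, and [y]
    any root of [q]. A relation [h] of [x] is reduced to 0 by cancelling leading terms against [p];
    the same cancellations applied to the image [k] against [q] show that [k] vanishes at [y]. *)
Lemma partial_aut_extend x :
  exists y, partial_aut (adjoin G x y).
Proof.
pose Pn n := boolp.asbool (exists h k : {poly L},
  [/\ poly_rel G h k, h != 0, root h x & size h = n]).
have : exists n, Pn n.
  have [p [p0 pK px]] := hA x; exists (size p); apply/boolp.asboolP.
  by exists p, p; split=> //; apply: poly_relK.
case/ex_minnP => n /boolp.asboolP[p [q [Hpq p0 px sp]]] nmin.
have : size q != 1%N.
  by rewrite -(poly_rel_size Hpq) neq_ltn (root_size_gt1 p0 px) orbT.
move/closed_rootP => [y qy]; exists y; apply: adjoin_partial_aut => h.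
have [m] := ubnP (size h); elim: m h => // m IH h hm k Hhk hx.
have [h0|h0] := eqVneq h 0.
  have : size k == 0%N by rewrite -(poly_rel_size Hhk) h0 size_poly0.
  by rewrite size_poly_eq0 => /eqP ->; rewrite horner0.
have ph : (size p <= size h)%N.
  rewrite sp; apply: nmin; apply/boolp.asboolP; exists h, k; split=> //.
  exact/rootP.
have lhk : G (lead_coef h, lead_coef k).
  by rewrite !lead_coefE -(poly_rel_size Hhk).
have lpq : G (lead_coef p, lead_coef q).
  by rewrite !lead_coefE -(poly_rel_size Hpq).
have [_ lV] := partial_autV lpq (ltac:(by rewrite lead_coef_eq0)).
have := IH _ (leq_trans (size_cancel_lead p0 ph) _)
  (k - (lead_coef k / lead_coef q)%:P * 'X^(size h - size p) * q).
rewrite !hornerE (rootP px) (rootP qy) hx !mulr0 !subr0; apply => //.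
apply: poly_relB => //; apply: poly_relM => //; apply: poly_relM.
  exact: poly_relC (GM lhk lV).
by apply: poly_relK; rewrite rpredX// polyOverX.
Qed.

End PartialAut.
(** Surjectivity is a counting argument: an injective map over [K] permutes the finitely many roots
    of any polynomial over [K], and every element of [L] is such a root. *)
Lemma GK_of_partial_aut (G : L * L -> Prop) : partial_aut G ->
  (forall x, exists y, G (x, y)) ->
  exists s, GK K s /\ forall x y, G (x, y) -> s x = y.
Proof.
move=> hG tot; have [s sP] := choice _ tot.
have sE x y : G (x, y) -> s x = y by apply: partial_aut_inj (sP x).
have [hk hB hM hF] := hG.
have sK k : k \in K -> s k = k by move=> kK; apply/sE/hk.
have sB x y : s (x - y) = s x - s y by apply: sE; apply: hB (sP x) (sP y).
have sM x y : s (x * y) = s x * s y by apply: sE; apply: hM (sP x) (sP y).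
have s0 : s 0 = 0 by apply/sK/rpred0.
have sN x : s (- x) = - s x by rewrite -sub0r sB s0 sub0r.
have sD x y : s (x + y) = s x + s y by rewrite -[y]opprK sB !sN !opprK.
have inj : injective s.
  move=> x y /eqP; rewrite -subr_eq0 -sB => h; apply/eqP; rewrite -subr_eq0.
  by apply: contraTT h => h; have [] := partial_autV hG (sP (x - y)) h.
have sX x n : s (x ^+ n) = s x ^+ n.
  by elim: n => [|n IH]; [rewrite !expr0 sK ?rpred1|rewrite !exprS sM IH].
have sh p x : p \is a polyOver K -> s p.[x] = p.[s x].
  move=> /polyOverP pK; rewrite !horner_coef (big_morph s sD s0).
  by apply: eq_bigr => i _; rewrite sM sX sK.
have surj y : exists x, s x = y.
  have [p [p0 pK py]] := hA y; have [rs [urs rsE]] := roots_of p0.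
  have sub : {subset map s rs <= rs}.
    move=> _ /mapP[x xr ->]; move: xr; rewrite !rsE !rootE -sh//.
    by move=> /eqP ->; rewrite s0.
  have us : uniq (map s rs) by rewrite map_inj_uniq.
  have [_ e] := uniq_min_size us sub (eq_leq (esym (size_map s rs))).
  have : y \in map s rs by rewrite e rsE.
  by case/mapP => x _ ->; exists x.
have [t tP] := choice _ surj.
exists s; split=> //; split=> //; first exact/sK/rpred1.
by exists t => x //; apply: inj; rewrite tP.
Qed.

(* Zorn's lemma on the subrings of [L * L] that are graphs of functions. *)
Lemma extend_partial_aut (G : L * L -> Prop) : partial_aut G ->
  exists s, GK K s /\ forall x y, G (x, y) -> s x = y.
Proof.
move=> hG.
(* Adding [G] inside [U] lets the empty chain have an upper bound: its union is empty, but [U] of it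
   is [G]. *)
pose U (A : L * L -> Prop) (z : L * L) := A z \/ G z.
pose P (A : classical_sets.set (L * L)) := partial_aut (U A).
have [F FP Ftot|A [PA Amax]] := @classical_sets.Zorn_bigcup _ P.
  pose BF := classical_sets.bigcup F id; rewrite -/BF.
  have chain a b : U BF a -> U BF b -> exists X : L * L -> Prop,
      [/\ partial_aut (U X), U X a, U X b & forall z, U X z -> U BF z].
    have incl X : F X -> forall z, U X z -> U BF z.
      by move=> FX z [Xz|]; [left; exists X|right].
    case=> [[X FX Xa]|Ga]; case=> [[Y FY Yb]|Gb].
    - have [XY|YX] := Ftot _ _ FX FY.
        by exists Y; split; [exact: FP|left; apply: XY|left|exact: incl].
      by exists X; split; [exact: FP|left|left; apply: YX|exact: incl].
    - by exists X; split; [exact: FP|left|right|exact: incl].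
    - by exists Y; split; [exact: FP|right|left|exact: incl].
    - exists (fun _ => False); split; [|by right|by right|].
        suff -> : U (fun _ => False) = G by [].
        by apply: boolp.funext => z; apply: boolp.propext; split; [case|right].
      by move=> z [|Gz] //; right.
  split.
  - by move=> k kK; right; case: hG => h _ _ _; apply: h.
  - by move=> a b ha hb; have [X [[_ h _ _] Xa Xb]] := chain _ _ ha hb; apply; apply: h.
  - by move=> a b ha hb; have [X [[_ _ h _] Xa Xb]] := chain _ _ ha hb; apply; apply: h.
  - by move=> y hy; have [X [[_ _ _ h] Xa _ _]] := chain _ _ hy hy; apply: h.
have tot x : exists y, U A (x, y).
  have [y hy] := partial_aut_extend PA x; exists y.
  apply: NNPP => nU; pose B := adjoin (U A) x y.
  have GB : U B = B.
    apply: boolp.funext => z; apply: boolp.propext; split; [case=> // Gz|by left].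
    by apply: adjoin_incl PA _ _ _ _; right.
  apply: (Amax B); last by rewrite /P GB.
  split; first by move=> z Az; apply: adjoin_incl PA _ _ _ _; left.
  by move=> BA; apply: nU; left; apply: BA; apply: adjoin_pt PA _ _.
have [s [sG sE]] := GK_of_partial_aut PA tot.
by exists s; split=> // x y Gxy; apply: sE; right.
Qed.

Section Over.
Variable T : {pred L}.
Hypotheses (hT : divring_closed T) (KT : {subset K <= T}).
HB.instance Definition _ := GRing.isDivringClosed.Build L T hT.

Lemma min_poly x : exists P : {poly L}, [/\ P != 0, P \is a polyOver T, root P x
  & forall Q, Q \is a polyOver T -> root Q x -> P %| Q].
Proof.
pose Pn n := boolp.asbool (exists P : {poly L},
  [/\ P != 0, P \is a polyOver T, root P x & size P = n]).
have : exists n, Pn n.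
  have [p [p0 /polyOverP pK px]] := hA x; exists (size p); apply/boolp.asboolP.
  by exists p; split=> //; apply/polyOverP => i; apply: KT.
case/ex_minnP => n /boolp.asboolP[P [P0 PT Px sP]] nmin.
exists P; split=> // Q QT Qx; apply: contraT => nd.
suff : (n <= size (Q %% P)%R)%N by rewrite leqNgt -sP ltn_modp P0.
apply: nmin; apply/boolp.asboolP; exists (Q %% P); split=> //.
- exact: polyOver_modp.
- have : root (Q %/ P * P + Q %% P) x by rewrite -divp_eq.
  by rewrite rootE hornerD hornerM (rootP Px) mulr0 add0r.
Qed.

(** The diagonal of [T] is a partial automorphism; the assumption on [x] and [y] is what makes it
    extend by sending [x] to [y]. *)
Lemma conjugate_aut x y :
  (forall Q, Q \is a polyOver T -> root Q x -> root Q y) ->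
  exists s, [/\ GK K s, forall t, t \in T -> s t = t & s x = y].
Proof.
move=> hxy; pose D (z : L * L) := z.1 \in T /\ z.1 = z.2.
have hD : partial_aut D.
  split=> [k /KT //|[a _] [b _] [/= aT <-] [/= bT <-]
    |[a _] [b _] [/= aT <-] [/= bT <-]|y' [_ /= <-] //].
  - by split=> //=; apply: rpredB.
  - by split=> //=; apply: rpredM.
have hDa : partial_aut (adjoin D x y).
  apply: adjoin_partial_aut => // h k hk hx.
  have e : h = k by apply/polyP => i; case: (hk i).
  rewrite -e; apply/rootP/hxy; last exact/rootP.
  by apply/polyOverP => i; case: (hk i).
have [s [sG sE]] := extend_partial_aut hDa; exists s; split=> //.
- by move=> t tT; apply/sE/adjoin_incl.
- exact/sE/adjoin_pt.
Qed.

(* The minimal polynomial [P] of [a] over [T] has [size P - 1] distinct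
   conjugate roots, and [Q - z], reduced modulo [P], vanishes at all of them. *)
Lemma fixed_in_simple_ext (h Q : {poly L}) a z :
  h \is a polyOver T -> separable_poly h -> root h a ->
  Q \is a polyOver T -> z = Q.[a] ->
  (forall s, GK K s -> (forall t, t \in T -> s t = t) -> s z = z) ->
  z \in T.
Proof.
move=> hTo hs ha QT zQ zfix.
have [P [P0 PT Pa Pmin]] := min_poly a.
have Ps : separable_poly P by apply: dvdp_separable hs; apply: Pmin.
have [rs Prs] := closed_field_poly_normal P.
have lP : lead_coef P != 0 by rewrite lead_coef_eq0.
have urs : uniq rs.
  rewrite -separable_prod_XsubC; apply: dvdp_separable Ps.
  by rewrite [X in _ %| X]Prs dvdpZr.
have rsE x : (x \in rs) = root P x by rewrite Prs rootZ// root_prod_XsubC.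
have sP : size P = (size rs).+1 by rewrite Prs size_scale// size_prod_XsubC.
pose Q' := Q %% P.
have Q'T : Q' \is a polyOver T by apply: polyOver_modp.
have Q'E x : root P x -> Q.[x] = Q'.[x].
  by move=> /rootP Px; rewrite {1}(divp_eq Q P) hornerD hornerM Px mulr0 add0r.
have allz : all (root (Q' - z%:P)) rs.
  apply/allP => b; rewrite rsE => Pb.
  have [s [sG sT sab]] := @conjugate_aut a b
    (fun R RT Ra => root_dvdp (Pmin R RT Ra) Pb).
  rewrite rootE hornerD hornerN hornerC subr_eq0 -Q'E// -(zfix s sG sT) zQ -sab.
  have [sD sM s1 _ _] := sG.
  have s0 : s 0 = 0 by apply: sT; apply: rpred0.
  have sX x n : s (x ^+ n) = s x ^+ n.
    by elim: n => [|n IH]; [rewrite !expr0 s1|rewrite !exprS sM IH].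
  rewrite !horner_coef (big_morph s sD s0); apply/eqP/eq_bigr => i _.
  by rewrite sM sX (sT Q`_i) ?(polyOverP QT).
have /eqP Qz0 : Q' - z%:P == 0.
  apply: contraTT isT => n0; have := max_poly_roots n0 allz urs.
  rewrite ltnNge => /negP; case; rewrite -ltnS -sP.
  apply: leq_ltn_trans (size_polyD _ _) _; rewrite size_polyN gtn_max.
  rewrite ltn_modp P0 size_polyC; apply: leq_ltn_trans (leq_b1 _) _.
  exact: root_size_gt1 Pa.
have -> : z = Q'`_0.
  by rewrite (subr0_eq Qz0) coefC.
exact: (polyOverP Q'T).
Qed.

End Over.
End Extension.

Section GaloisGroup.
Variables (L : closedFieldType) (K : {pred L}).
Hypotheses (hK : divring_closed K) (hA : K_algebraic_closure K).
HB.instance Definition _ := GRing.isDivringClosed.Build L K hK.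

Lemma GK_rmorphism s : GK K s -> exists f : {rmorphism L -> L}, s = f.
Proof.
move=> [sD sM s1 _ _].
have sB : zmod_morphism s.
  move=> x y; have s0 : s 0 = 0 by apply: (addrI (s 0)); rewrite -sD !addr0.
  have sN : s (- y) = - s y by apply/eqP; rewrite -addr_eq0 -sD addNr s0.
  by rewrite sD sN.
have sM' : monoid_morphism s by split.
pose f : {rmorphism L -> L} := HB.pack s (GRing.isZmodMorphism.Build L L s sB)
  (GRing.isMonoidMorphism.Build L L s sM').
by exists f.
Qed.

Lemma GK_fix s k : GK K s -> k \in K -> s k = k.
Proof. by move=> [_ _ _ _ h]; apply: h. Qed.

Lemma GK_comp s t : GK K s -> GK K t -> GK K (s \o t).
Proof.
move=> [sD sM s1 sb sK] [tD tM t1 tb tK]; split=> /=.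
- by move=> x y; rewrite tD sD.
- by move=> x y; rewrite tM sM.
- by rewrite t1 s1.
- exact: bij_comp.
- by move=> k kK; rewrite tK// sK.
Qed.

Lemma GK_id : GK K id.
Proof. by split=> //; exists id. Qed.

Lemma GK_inv s : GK K s -> exists t, [/\ GK K t, cancel s t & cancel t s].
Proof.
move=> [sD sM s1 sb sK]; have [t st ts] := sb; exists t; split=> //; split.
- by move=> x y; apply: (bij_inj sb); rewrite sD !ts.
- by move=> x y; apply: (bij_inj sb); rewrite sM !ts.
- by rewrite -[X in t X]s1 st.
- by exists s.
- by move=> k kK; rewrite -[X in t X](sK k kK) st.
Qed.

Lemma GK_horner s p x : GK K s -> p \is a polyOver K -> s p.[x] = p.[s x].
Proof.
move=> sG /polyOverP pK; have sK := GK_fix sG.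
have [f ef] := GK_rmorphism sG; rewrite ef in sK *.
rewrite -horner_map; congr (_.[_]); apply/polyP => i.
by rewrite coef_map /= sK.
Qed.

Lemma GK_root s p x : GK K s -> p \is a polyOver K -> root p x -> root p (s x).
Proof.
move=> sG pK /rootP px; apply/rootP; rewrite -GK_horner// px.
by have [f ->] := GK_rmorphism sG; rewrite rmorph0.
Qed.

Lemma subring_divring (S : {pred L}) :
  subring_closed S -> {subset K <= S} -> divring_closed S.
Proof.
move=> hS KS; have [S1 SB SM] := hS; split=> // x y xS yS.
have [->|y0] := eqVneq y 0; first by rewrite invr0 mulr0 -(subrr 1) SB.
apply: SM => //; have [Q /polyOverP QK ->] := alg_inv hK hA y0.
pose H := GRing.isSubringClosed.Build L S hS.
pose S' : subringClosed L := HB.pack S H.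
have : Q.[y] \in S'; last by [].
apply: rpred_horner => //; apply/polyOverP => i; exact: KS.
Qed.

Fixpoint adjoin_seq (A : seq L) : {pred L} :=
  if A is a :: A' then
    fun x => boolp.asbool (exists2 Q, Q \is a polyOver (adjoin_seq A') & x = Q.[a])
  else K.

Lemma adjoin_seqP A : [/\ divring_closed (adjoin_seq A),
  {subset K <= adjoin_seq A} & {subset A <= adjoin_seq A}].
Proof.
elim: A => [|a A [dA KA AA]] /=; first by split.
pose S : {pred L} := fun x =>
  boolp.asbool (exists2 Q, Q \is a polyOver (adjoin_seq A) & x = Q.[a]).
rewrite -/S.
pose T : divringClosed L := HB.pack (adjoin_seq A)
  (GRing.isDivringClosed.Build L (adjoin_seq A) dA).
have inS Q : Q \is a polyOver T -> Q.[a] \in S.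
  by move=> QT; apply/boolp.asboolP; exists Q.
have AS : {subset adjoin_seq A <= S}.
  by move=> x xA; rewrite -(hornerC x a); apply: inS; rewrite polyOverC.
have KS : {subset K <= S} by move=> k /KA; apply: AS.
split=> //.
- apply: subring_divring => //; split.
  + by apply: KS; apply: rpred1.
  + move=> _ _ /boolp.asboolP[P PT ->] /boolp.asboolP[Q QT ->].
    by rewrite -hornerN -hornerD; apply: inS; apply: rpredB.
  + move=> _ _ /boolp.asboolP[P PT ->] /boolp.asboolP[Q QT ->].
    by rewrite -hornerM; apply: inS; apply: rpredM.
- move=> x; rewrite inE => /orP[/eqP ->|/AA /AS //].
  by rewrite -(hornerX a); apply: inS; rewrite polyOverX.
Qed.

(** Remove the generators one at a time with [fixed_in_simple_ext]; a separable polynomial over [K]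
    remains one over each intermediate field. *)
Lemma fixed_in_base (A : seq L) z :
  (forall a, a \in A ->
     exists h, [/\ h \is a polyOver K, separable_poly h & root h a]) ->
  z \in adjoin_seq A -> (forall s, GK K s -> s z = z) -> z \in K.
Proof.
move=> hsep zA zfix; elim: A hsep zA => //= a A IH hsep.
move=> /boolp.asboolP[Q QT zQ]; have [dA KA _] := adjoin_seqP A.
apply: IH; first by move=> b bA; apply: hsep; rewrite inE bA orbT.
have [h [/polyOverP hh hs ha]] := hsep a (mem_head a A).
apply: (fixed_in_simple_ext hK hA dA KA _ hs ha QT zQ).
  by apply/polyOverP => i; apply: KA.
by move=> s sG _; apply: zfix.
Qed.

End GaloisGroup.

(** * Invariance of the valuation *)

Section Complete.
Variables (L : closedFieldType) (K : {pred L}) (v : L -> rat).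
Hypotheses (hK : divring_closed K) (hv : is_valuation v) (hc : K_complete K v).
HB.instance Definition _ := GRing.isDivringClosed.Build L K hK.

Lemma vge_all0 (x : L) : (forall N : nat, vge v x N%:R) -> x = 0.
Proof.
move=> h; apply/eqP; apply: contraT => x0.
have := h (Num.trunc `|v x|).+1; rewrite vgeE// leNgt => /negP; case.
by apply: le_lt_trans (ler_norm _) _; rewrite truncnS_gt.
Qed.

Lemma exists_nat_ge (C : rat) : exists N : nat, C <= N%:R.
Proof.
exists (Num.trunc `|C|).+1; apply/ltW.
by apply: le_lt_trans (ler_norm _) _; rewrite truncnS_gt.
Qed.

(* If [x n] were a limit of combinations of the previous vectors, completeness
   of [K] would make it one of them. *)
Lemma coord_bound (x : nat -> L) n :
  (forall a : nat -> L, (forall i, a i \in K) -> \sum_(i < n) a i * x i = 0 ->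
     forall i, (i < n)%N -> a i = 0) ->
  exists C, forall (a : nat -> L) w, (forall i, a i \in K) ->
    vge v (\sum_(i < n) a i * x i) w ->
    forall i, (i < n)%N -> vge v (a i) (w - C).
Proof.
elim: n => [|n IH] indep; first by exists 0.
have [|C HC] := IH.
  move=> a aK a0 i ilt; pose a' j := if (j < n)%N then a j else 0.
  have := indep a' _ _ i (leqW ilt); rewrite /a' ilt; apply.
    by move=> j; case: ifP => _ //; apply: rpred0.
  rewrite big_ord_recr /= ltnn mul0r addr0 -[RHS]a0.
  by apply: eq_bigr => j _; rewrite ltn_ord.
(* [C0] bounds how well [x n] is approximated by combinations of the earlier vectors. Otherwise
   there are approximations of every quality; by the induction hypothesis their coefficients form
   Cauchy sequences. *)
have [C0 HC0] : exists C0 : rat, forall a : nat -> L, (forall i, a i \in K) ->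
    ~~ vge v (x n + \sum_(i < n) a i * x i) C0.
  apply: NNPP => hno.
  have hN (N : nat) : exists a : nat -> L, (forall i, a i \in K) /\
      vge v (x n + \sum_(i < n) a i * x i) N%:R.
    apply: NNPP => hN; apply: hno; exists N%:R => a aK; apply/negP => ha.
    by apply: hN; exists a.
  have [a aP] := choice _ hN.
  have close M N D : (D <= M)%N -> (D <= N)%N ->
      vge v (\sum_(i < n) (a M i - a N i) * x i) D%:R.
    move=> DM DN.
    have -> : \sum_(i < n) (a M i - a N i) * x i =
        (x n + \sum_(i < n) a M i * x i) - (x n + \sum_(i < n) a N i * x i).
      rewrite opprD addrACA subrr add0r -sumrB.
      by apply: eq_bigr => i _; rewrite mulrBl.
    apply: vgeB => //; [have [_ h] := aP M|have [_ h] := aP N];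
      by apply: vge_le h; rewrite ler_nat.
  have [N0 HN0] := exists_nat_ge C.
  have cau i : (i < n)%N -> Kcauchy v (fun N => a N i).
    move=> ilt N; exists (N + N0)%N => M M' hM hM'.
    have hk j : a M j - a M' j \in K.
      by apply: rpredB; [have [h _] := aP M|have [h _] := aP M'].
    have := HC (fun j => a M j - a M' j) _ hk (close M M' (N + N0)%N hM hM') i ilt.
    by apply: vge_le; rewrite natrD lerBrDr lerD2l.
  have hl i : exists l, (i < n)%N -> l \in K /\ Kconverges v (fun N => a N i) l.
    have [ilt|_] := boolP (i < n)%N; last by exists 0.
    have [|l lK hl] := hc _ (cau i ilt); first by move=> N; have [] := aP N.
    by exists l.
  have [l lP] := choice _ hl.
  (* The limit relation: [x n] has coefficient 1, so its vanishing contradicts independence. *)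
  pose b i := if (i < n)%N then l i else 1.
  have bK i : b i \in K.
    by rewrite /b; case: ifP => [/lP[] //|_]; apply: rpred1.
  suff b0 : \sum_(i < n.+1) b i * x i = 0.
    have := indep b bK b0 n (leqnn _); rewrite /b ltnn => /eqP.
    by rewrite oner_eq0.
  apply: vge_all0 => N.
  have [D HD] : exists D : nat, forall i : 'I_n,
      N%:R <= D%:R + v (x i).
    have [D hD] := choice _ (fun i : 'I_n => exists_nat_ge (N%:R - v (x i))).
    exists (\max_(i < n) D i)%N => i; rewrite -lerBlDr.
    by apply: le_trans (hD i) _; rewrite ler_nat leq_bigmax.
  have [M HM] : exists M : nat, forall (i : 'I_n) m, (M <= m)%N ->
      vge v (a m i - l i) D%:R.
    have h (i : 'I_n) := (lP i (ltn_ord i)).2 D.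
    have [M hM] := choice _ h; exists (\max_(i < n) M i)%N => i m hm.
    by apply: hM; apply: leq_trans hm; apply: leq_bigmax.
  pose m := maxn M N; have [_ am] := aP m.
  have -> : \sum_(i < n.+1) b i * x i =
      (x n + \sum_(i < n) a m i * x i) - \sum_(i < n) (a m i - l i) * x i.
    rewrite big_ord_recr /= /b ltnn mul1r addrC -addrA; congr (_ + _).
    rewrite -sumrB; apply: eq_bigr => i _.
    by rewrite ltn_ord mulrBl opprB addrC subrK.
  apply: vgeB => //.
    by apply: vge_le am => //; rewrite ler_nat leq_maxr.
  apply: vge_sum => // i _; apply: vge_le (HD i) _ => //.
  by apply: vgeM (vge_refl _ _) => //; apply: HM; apply: leq_maxl.
(* If [v (a n)] were below [w - C0], dividing by [a n] would approximate [x n] too well. Moving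
   [a n * x n] to the other side then costs at most [Num.max 0 (C0 - v (x n))], and the induction
   hypothesis costs [C] more. *)
exists (Num.max C0 (C + Num.max 0 (C0 - v (x n)))) => a w aK hw.
have han : vge v (a n) (w - C0).
  have [->|an0] := eqVneq (a n) 0; first exact: vge0.
  rewrite vgeE// leNgt; apply/negP => hlt.
  have h i : (a n)^-1 * a i \in K by apply: rpredM => //; rewrite rpredV.
  apply: (negP (HC0 _ h)).
  have -> : x n + \sum_(i < n) (a n)^-1 * a i * x i =
      (a n)^-1 * \sum_(i < n.+1) a i * x i.
    rewrite big_ord_recr /= mulrDr mulKf// addrC mulr_sumr; congr (_ + _).
    by apply: eq_bigr => i _; rewrite mulrA.
  have := vgeM hv (vge_refl v (a n)^-1) hw; apply: vge_le => //.
  by rewrite valV//; lra.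
have hrest : vge v (\sum_(i < n) a i * x i) (w - Num.max 0 (C0 - v (x n))).
  have -> : \sum_(i < n) a i * x i = \sum_(i < n.+1) a i * x i - a n * x n.
    by rewrite big_ord_recr /= addrK.
  apply: vgeB => //.
    by apply: vge_le hw => //; rewrite lerBlDr lerDl le_max lexx.
  apply: vge_le (vgeM hv han (vge_refl v (x n))) => //.
  by rewrite -addrA lerD2l lerNl opprD opprK le_max addrC orbC lexx.
move=> i; rewrite ltnS leq_eqVlt => /orP[/eqP ->|ilt].
  by apply: vge_le han => //; rewrite lerD2l lerN2 le_max lexx.
apply: vge_le (HC a _ aK hrest i ilt) => //.
by rewrite -addrA lerD2l -opprD lerN2 le_max [_ + C]addrC lexx orbT.
Qed.

Hypothesis hA : K_algebraic_closure K.

(** Reduce [x ^+ m] modulo the minimal polynomial. By [coord_bound] its coordinates have valuation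
    at least [m%:R * v x - C], and [s] fixes them, so [s x ^+ m] has valuation at least
    [m%:R * v x - C + c]. As [C] and [c] do not depend on [m], a large [m] gives the inequality. *)
Lemma val_GK_ge s x : GK K s -> x != 0 -> v x <= v (s x).
Proof.
move=> sG x0; have [P [P0 PK Px Pmin]] := min_poly hK hA hK (fun _ h => h) x.
have [f ef] := GK_rmorphism sG.
have sx0 : s x != 0 by rewrite ef fmorph_eq0.
pose n := (size P).-1.
have sP : size P = n.+1 by rewrite /n prednK// size_poly_gt0.
have [|C HC] := @coord_bound (fun i => x ^+ i) n.
  move=> a aK a0 i ilt; pose Q := \poly_(i < n) a i.
  have QK : Q \is a polyOver K.
    by apply/polyOverP => j; rewrite coef_poly; case: ifP => _ //; apply: rpred0.
  have Qx : root Q x by rewrite rootE /Q horner_poly a0.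
  have Q0 : Q = 0.
    apply/eqP; apply: contraTT (Pmin _ QK Qx) => Q0.
    apply/negP => /(dvdp_leq Q0); rewrite sP leqNgt => /negP; apply.
    exact: size_poly.
  by have := coef_poly n a i; rewrite ilt -/Q Q0 coef0.
have [c hc'] : exists c, forall i : 'I_n, vge v (s x ^+ i) c.
  exists (\sum_(i < n) - `|v (s x ^+ i)|) => i; rewrite vgeE ?expf_neq0//.
  rewrite (bigD1 i)//=; apply: (@le_trans _ _ (- `|v (s x ^+ i)|)).
    by rewrite gerDl; apply: sumr_le0 => j _; rewrite oppr_le0.
  by rewrite lerNl -normrN ler_norm.
have key (m : nat) : m%:R * v x - C + c <= m%:R * v (s x).
  pose R := 'X^m %% P.
  have RK : R \is a polyOver K.
    by apply: polyOver_modp => //; rewrite rpredX// polyOverX.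
  have Rs : (size R <= n)%N by rewrite -ltnS -sP ltn_modp.
  have Rx : x ^+ m = \sum_(i < n) R`_i * x ^+ i.
    have := congr1 (fun p : {poly L} => p.[x]) (divp_eq 'X^m P).
    rewrite hornerD hornerM (rootP Px) mulr0 add0r hornerXn => ->.
    exact: horner_coef_wide.
  have Rsx : s x ^+ m = \sum_(i < n) R`_i * s x ^+ i.
    rewrite -(horner_coef_wide _ Rs) -(GK_horner hK x sG RK).
    by rewrite (horner_coef_wide _ Rs) -Rx ef rmorphXn.
  have := HC (fun i => R`_i) (m%:R * v x) (polyOverP RK).
  rewrite -Rx vgeE ?expf_neq0// valX// lexx => /(_ isT) hR.
  have : vge v (s x ^+ m) (m%:R * v x - C + c).
    rewrite Rsx; apply: vge_sum => // i _; apply: vgeM => //.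
    by apply: hR.
  by rewrite vgeE ?expf_neq0// valX.
rewrite leNgt; apply/negP => lt.
have d0 : 0 < v x - v (s x) by rewrite subr_gt0.
have [m hm] := exists_nat_ge ((C - c) / (v x - v (s x)) + 1).
have := key m; have : (C - c) / (v x - v (s x)) < m%:R by lra.
rewrite ltr_pdivrMr// mulrBr; lra.
Qed.

Lemma val_GK s x : GK K s -> x != 0 -> v (s x) = v x.
Proof.
move=> sG x0; apply/eqP; rewrite eq_le [X in _ && X]val_GK_ge// andbT.
have [f ef] := GK_rmorphism sG.
have := val_GK_ge sG (invr_neq0 x0).
by rewrite ef fmorphV !valV ?fmorph_eq0// lerN2.
Qed.

Lemma vge_GK s x d : GK K s -> vge v (s x) d = vge v x d.
Proof.
move=> sG; rewrite /vge; have [f ef] := GK_rmorphism sG; rewrite ef fmorph_eq0 -ef.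
by case: eqVneq => //= x0; rewrite val_GK.
Qed.

Lemma vgt_GK s x d : GK K s -> vgt v (s x) d = vgt v x d.
Proof.
move=> sG; rewrite /vgt; have [f ef] := GK_rmorphism sG; rewrite ef fmorph_eq0 -ef.
by case: eqVneq => //= x0; rewrite val_GK.
Qed.

End Complete.

(** * The residue field and wild inertia *)

Lemma pigeonhole (T : finType) (f : nat -> T) :
  exists a b, (a < b)%N /\ f a = f b.
Proof.
pose g (i : 'I_(#|T|.+1)) := f i.
have /injectivePn[x [y xy gxy]] : ~~ injectiveb g.
  by apply/negP => /injectiveP/leq_card; rewrite card_ord ltnn.
have [lt|gt|/val_inj e] := ltngtP (val x) (val y).
- by exists x, y.
- by exists y, x.
- by rewrite e eqxx in xy.
Qed.

Lemma exists_nth_root (L : closedFieldType) n (a : L) : (0 < n)%N ->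
  exists y, y ^+ n = a.
Proof.
move=> n0; have : size ('X^n - a%:P) != 1%N by rewrite size_XnsubC// eqSS -lt0n.
move/closed_rootP => [y]; rewrite rootE !hornerE subr_eq0 => /eqP.
by exists y.
Qed.

Section Residue.
Variables (L : closedFieldType) (K : {pred L}) (v : L -> rat).
Hypotheses (hK : divring_closed K) (hA : K_algebraic_closure K).
Hypotheses (hv : is_valuation v) (hr : finite_residue_field K v).
HB.instance Definition _ := GRing.isDivringClosed.Build L K hK.

Lemma OKP x : reflect (x \in K /\ vge v x 0) (x \in OK K v).
Proof. exact: andP. Qed.

Lemma OK_add x y : x \in OK K v -> y \in OK K v -> x + y \in OK K v.
Proof.
move=> /OKP[xK x0] /OKP[yK y0]; apply/OKP; split; first exact: rpredD.
exact: vgeD.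
Qed.

Lemma OK_mul x y : x \in OK K v -> y \in OK K v -> x * y \in OK K v.
Proof.
move=> /OKP[xK x0] /OKP[yK y0]; apply/OKP; split; first exact: rpredM.
exact: vgeM0.
Qed.

Lemma OK_nat n : n%:R \in OK K v.
Proof. by apply/OKP; split; [apply: rpred_nat|apply: vge_nat]. Qed.

Lemma vgtM_prime x y : vge v x 0 -> vge v y 0 -> vgt v (x * y) 0 ->
  vgt v x 0 \/ vgt v y 0.
Proof.
move=> hx hy; have [|[x0 vx]] := vgeP hx; first by left.
have [|[y0 vy]] := vgeP hy; first by right.
by rewrite vgtE ?mulf_neq0// valM// vx vy addr0 ltxx.
Qed.

Lemma vgtX_prime x n : vge v x 0 -> vgt v (x ^+ n) 0 -> vgt v x 0.
Proof.
move=> hx; elim: n => [|n IH]; first by rewrite expr0 vgt1.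
by rewrite exprS => /vgtM_prime [] //; apply: vgeX.
Qed.

(* Normalising a polynomial relation at the last coefficient of minimal
   valuation makes it monic of degree [n] over the residue field. *)
Lemma integral_relation y : vge v y 0 -> exists n (c : nat -> L),
  (forall i, c i \in OK K v) /\ vgt v (y ^+ n - \sum_(i < n) c i * y ^+ i) 0.
Proof.
move=> hy; have [p [p0 /polyOverP pK /rootP py]] := hA y.
have sp : (0 < size p)%N by rewrite size_poly_gt0.
pose l : 'I_(size p) := Ordinal (ltac:(by rewrite prednK) : ((size p).-1 < size p)%N).
have hl : p`_l != 0 by rewrite /= -lead_coefE lead_coef_eq0.
case: (@Order.TotalTheory.arg_minP _ _ _ l (fun i => p`_i != 0) (fun i => v p`_i) hl).
move=> i0 hi0 mini0.
pose Q (i : 'I_(size p)) := (p`_i != 0) && (v p`_i == v p`_i0).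
have Qi0 : Q i0 by rewrite /Q hi0 eqxx.
case: (@arg_maxnP _ i0 Q (fun i : 'I_(size p) => i : nat) Qi0).
move=> n /andP[pn0 /eqP vn] maxn.
have rel (i : nat) : vge v (p`_i / p`_n) 0.
  have [->|pi0] := eqVneq p`_i 0; first by rewrite mul0r vge0.
  have ilt : (i < size p)%N by rewrite ltnNge; apply: contra pi0 => /(nth_default 0) ->.
  rewrite vgeE ?mulf_neq0 ?invr_neq0// valM ?invr_neq0// valV// subr_ge0 vn.
  exact: (mini0 (Ordinal ilt)).
exists n, (fun i => - (p`_i / p`_n)); split.
  by move=> i; apply/OKP; rewrite vgeN// rpredN rpred_div.
have e : y ^+ n - \sum_(i < n) - (p`_i / p`_n) * y ^+ i =
    - \sum_(n.+1 <= i < size p) (p`_i / p`_n) * y ^+ i.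
  apply/eqP; rewrite -addr_eq0; apply/eqP.
  transitivity ((p`_n)^-1 * p.[y]); last by rewrite py mulr0.
  rewrite horner_coef mulr_sumr -(big_mkord xpredT (fun i => (p`_n)^-1 * (p`_i * y ^+ i))).
  rewrite [RHS](@big_cat_nat _ _ _ n)//= ?(ltnW (ltn_ord n))//.
  rewrite [X in _ = _ + X](big_ltn (ltn_ord n)).
  rewrite mulKf// big_mkord addrA [_ + y ^+ n]addrC; congr (_ + _ + _).
    by rewrite -sumrN; apply: eq_bigr => i _; rewrite mulNr opprK mulrA [_^-1 * _]mulrC.
  by apply: eq_bigr => i _; rewrite mulrA [_^-1 * _]mulrC.
rewrite e vgtN// big_seq_cond; apply: vgt_sum => // i.
rewrite andbT mem_index_iota => /andP[ni ilt].
apply: vgtM0 (vgeX hv _ hy) => //.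
have [hgt//|[]] := vgeP (rel i).
rewrite mulf_eq0 invr_eq0 (negPf pn0) orbF => pi0.
rewrite valM ?invr_neq0// valV// => /eqP; rewrite subr_eq0 vn => vi.
have := maxn (Ordinal ilt); rewrite /Q /= pi0 vi => /(_ isT).
by rewrite leqNgt ni.
Qed.

(** Modulo the maximal ideal [y] is a root of a monic polynomial, so multiplication by [y] never
    leaves the span of its first [n] powers. The degree is positive, since 1 is not in the maximal
    ideal. *)
Lemma pow_reduce y : vge v y 0 -> exists n, forall m, exists c : nat -> L,
  (forall i, c i \in OK K v) /\ vgt v (y ^+ m - \sum_(i < n) c i * y ^+ i) 0.
Proof.
move=> hy; have [[|n] [d [dO dy]]] := integral_relation hy.
  by move: dy; rewrite big_ord0 subr0 expr0 vgt1.
exists n.+1; elim=> [|m [c [cO cy]]].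
  exists (fun i => (i == 0)%:R); split; first by move=> i; apply: OK_nat.
  rewrite big_ord_recl /= expr0 mulr1 big1 ?addr0 ?subrr ?vgt0// => i _.
  by rewrite mul0r.
exists (fun i => (if i is j.+1 then c j else 0) + c n * d i); split.
  by move=> [|i]; apply: OK_add; rewrite ?OK_mul//; apply: (OK_nat 0).
have -> : y ^+ m.+1 - \sum_(i < n.+1)
    ((if i : nat is j.+1 then c j else 0) + c n * d i) * y ^+ i =
  y * (y ^+ m - \sum_(i < n.+1) c i * y ^+ i)
   + c n * (y ^+ n.+1 - \sum_(i < n.+1) d i * y ^+ i).
  under eq_bigr => i _ do rewrite mulrDl -mulrA.
  rewrite big_split /= -mulr_sumr big_ord_recl /= mul0r add0r.
  rewrite [\sum_(i < n.+1) c i * _]big_ord_recr /=.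
  set D := \sum_(i < n.+1) d i * _; rewrite !mulrBr mulrDr [y * \sum_(i < n) _]mulr_sumr.
  have -> : \sum_(i < n) y * (c i * y ^+ i) = \sum_(i < n) c i * y ^+ bump 0 i.
    by apply: eq_bigr => i _; rewrite mulrCA -exprS.
  rewrite !exprS; ring.
by apply: vgtD => //; [apply: vgtMl0|apply: vgtMl0 => //; case/OKP: (cO n)].
Qed.

Lemma residue_rep : exists (n : nat) (rho : 'I_n -> L),
  (forall k, vge v (rho k) 0) /\
  exists f : L -> 'I_n, forall x, x \in OK K v -> vgt v (x - rho (f x)) 0.
Proof.
have [reps [/allP repsO repsP]] := hr.
exists (size reps), (fun k => reps`_k); split.
  by move=> k; have /OKP[] := repsO _ (mem_nth 0 (ltn_ord k)).
have ex x : exists k : 'I_(size reps), x \in OK K v -> vgt v (x - reps`_k) 0.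
  have [xO|_] := boolP (x \in OK K v).
    have [a ar xa] := repsP _ xO; rewrite -index_mem in ar.
    by exists (Ordinal ar); rewrite /= nth_index// -index_mem.
  have [a ar _] := repsP _ (OK_nat 0); rewrite -index_mem in ar.
  by exists (Ordinal ar).
exact: (choice _ ex).
Qed.

(** By [pow_reduce] the class of a power of [y] depends only on [n] residues, so two powers agree
    modulo the maximal ideal; divide one by the other. *)
Lemma unit_pow_eq1 y : y != 0 -> v y = 0 ->
  exists2 N, (0 < N)%N & vgt v (y ^+ N - 1) 0.
Proof.
move=> y0 vy; have hy : vge v y 0 by rewrite vgeE// vy.
have [n red] := pow_reduce hy; have [c cP] := choice _ red.
have [q [rho [rho0 [f fP]]]] := residue_rep.
have [a [b [ab]]] := pigeonhole (fun m => [ffun i : 'I_n => f (c m i)]).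
move=> /ffunP fab.
have near m : vgt v (y ^+ m - \sum_(i < n) rho (f (c m i)) * y ^+ i) 0.
  have [cO cy] := cP m.
  have h : vgt v (\sum_(i < n) (c m i - rho (f (c m i))) * y ^+ i) 0.
    by apply: vgt_sum => // i _; apply: vgtM0 (fP _ (cO i)) (vgeX hv i hy).
  have := vgtD hv cy h; congr (vgt v _ _).
  under [X in _ + X = _]eq_bigr => i _ do rewrite mulrBl.
  by rewrite sumrB addrA subrK.
have : vgt v (y ^+ b - y ^+ a) 0.
  have := vgtB hv (near b) (near a); congr (vgt v _ _).
  have -> : \sum_(i < n) rho (f (c b i)) * y ^+ i =
            \sum_(i < n) rho (f (c a i)) * y ^+ i.
    by apply: eq_bigr => i _; have := fab i; rewrite !ffunE => ->.
  by rewrite opprB addrA subrK.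
exists (b - a)%N; first by rewrite subn_gt0.
have -> : y ^+ (b - a) - 1 = (y ^+ b - y ^+ a) * (y ^+ a)^-1.
  have ya0 : y ^+ a != 0 by apply: expf_neq0.
  have yba : y ^+ b = y ^+ (b - a) * y ^+ a by rewrite -exprD subnK// ltnW.
  by rewrite yba mulrBl mulfK// divff.
by apply: vgtM0 => //; rewrite vgeE ?invr_neq0 ?expf_neq0// valV ?expf_neq0// valX// vy mulr0.
Qed.

(** [p] is the least positive integer of the maximal ideal, which exists because two integers share
    a residue. Division with remainder gives the criterion, and primality of the ideal gives that of
    [p]. *)
Lemma residue_char : exists2 p, prime p & forall n, vgt v n%:R 0 = (p %| n)%N.
Proof.
have [q [rho [rho0 [f fP]]]] := residue_rep.
have : exists n, (0 < n)%N && vgt v n%:R 0.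
  have [a [b [ab fab]]] := pigeonhole (fun m => f m%:R).
  exists (b - a)%N; rewrite subn_gt0 ab natrB ?(ltnW ab)//.
  have := vgtB hv (fP _ (OK_nat b)) (fP _ (OK_nat a)).
  by rewrite fab opprB addrA subrK.
case/ex_minnP => p /andP[p0 vp] pmin.
have small n : (0 < n)%N -> (n < p)%N -> vgt v n%:R 0 = false.
  move=> n0 np; apply/negP => vn; have := pmin n; rewrite n0 vn leqNgt np.
  by move/(_ isT).
have dvd n : vgt v n%:R 0 = (p %| n)%N.
  have e : n%:R = (n %/ p)%:R * p%:R + (n %% p)%:R :> L.
    by rewrite -natrM -natrD -divn_eq.
  have hp : vgt v ((n %/ p)%:R * p%:R) 0 by apply: vgtMl0 => //; apply: vge_nat.
  have -> : vgt v n%:R 0 = vgt v (n %% p)%:R 0.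
    apply/idP/idP => h; last by rewrite e; apply: vgtD.
    have -> : (n %% p)%:R = n%:R - (n %/ p)%:R * p%:R :> L by rewrite e addrC addKr.
    exact: vgtB.
  rewrite /dvdn; have [->|m0] := posnP (n %% p)%N; first by rewrite vgt0.
  by rewrite small// ?ltn_pmod//; apply/esym/negbTE; rewrite -lt0n.
exists p => //; apply/primeP; split.
  by rewrite ltn_neqAle p0 andbT; apply/eqP => p1; move: vp; rewrite -p1 vgt1.
move=> d /dvdnP[e pe]; have := vp; rewrite pe natrM.
case/vgtM_prime; rewrite ?vge_nat// dvd pe => h.
  have e0 : (0 < e)%N by move: p0; rewrite pe muln_gt0 => /andP[].
  have := dvdn_leq e0 h; rewrite -{2}[e]muln1 leq_pmul2l// => d1.
  have d0 : (0 < d)%N by move: p0; rewrite pe muln_gt0 => /andP[].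
  by apply/orP; left; rewrite eqn_leq d1 d0.
have d0 : (0 < d)%N by move: p0; rewrite pe muln_gt0 => /andP[].
have e0 : (0 < e)%N by move: p0; rewrite pe muln_gt0 => /andP[].
by apply/orP; right; rewrite eqn_leq (dvdn_leq d0 h) leq_pmull.
Qed.

Section ResidueChar.
Variable p : nat.
Hypotheses (pP : prime p) (pE : forall n, vgt v n%:R 0 = (p %| n)%N).

(** The inner binomial coefficients are divisible by [p], so [w ^+ p - 1] is congruent to
    [(w - 1) ^+ p]. *)
Lemma frobenius_inj w j : vge v w 0 -> vgt v (w ^+ (p ^ j) - 1) 0 -> vgt v (w - 1) 0.
Proof.
elim: j w => [|j IH] w hw; first by rewrite expn0 expr1.
rewrite expnS exprM => h; have {}h := IH _ (vgeX hv p hw) h.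
have hx : vge v (w - 1) 0 by apply: vgeB => //; apply: vge1.
apply: (@vgtX_prime _ p) => //.
have [q pq] : exists q, p = q.+1 by exists p.-1; rewrite prednK// prime_gt0.
pose S := \sum_(i < q) (w - 1) ^+ bump 0 i *+ 'C(p, bump 0 i).
have e : w ^+ p - 1 = S + (w - 1) ^+ p.
  rewrite -{1}[w](subrK 1) exprD1n /S pq big_ord_recr big_ord_recl /=.
  rewrite binn bin0 expr0 !mulr1n; ring.
have hS : vgt v S 0.
  apply: vgt_sum => // i _; rewrite -mulr_natr; apply: vgtMl0; rewrite ?vgeX//.
  rewrite pE; apply: prime_dvd_bin => //.
  by rewrite pq /bump /= add1n ltnS.
by have := vgtB hv h hS; rewrite e addrC addKr.
Qed.


Hypothesis hc : K_complete K v.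
Variable pi : L.
Hypotheses (piK : pi \in K) (pi0 : pi != 0).
Hypothesis pi_span : forall x, x != 0 ->
  exists M (k : int), (0 < M)%N /\ M%:R * v x = k%:~R * v pi.

Lemma valXz x k : x != 0 -> v (x ^ k) = k%:~R * v x.
Proof.
move=> x0; case: k => n; first by rewrite -exprnP valX.
by rewrite NegzE -exprnN valV ?expf_neq0// valX// mulrNz mulNr.
Qed.

(* If [x^(p^j e)] is [pi^k] up to a principal unit, then [x^(p^j)] is, up to
   principal units, a product of roots of [pi] and roots of unity of order
   dividing [e]; these are fixed by [s], and [p]-power roots are unique modulo
   the maximal ideal. *)
Lemma fix_roots_wild s : GK K s ->
  (forall e y, ~~ (p %| e)%N -> y ^+ e = pi -> s y = y) -> wild_inertia K v s.
Proof.
move=> sG sfix; split=> // x x0.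
have [f ef] := GK_rmorphism sG.
have sx0 : s x != 0 by rewrite ef fmorph_eq0.
have [M [k [M0 vM]]] := pi_span x0.
pose u := x ^+ M / pi ^ k.
have pk0 i : pi ^ i != 0 by rewrite expfz_neq0.
have u0 : u != 0 by rewrite mulf_neq0 ?invr_neq0 ?expf_neq0.
have vu : v u = 0.
  by rewrite valM ?invr_neq0 ?expf_neq0// valV// valX// valXz// vM subrr.
have [N N0 hu] := unit_pow_eq1 u0 vu.
have MN0 : (0 < M * N)%N by rewrite muln_gt0 M0.
have [e pe MNe] := pfactor_coprime pP MN0.
have {}pe : ~~ (p %| e)%N by rewrite -prime_coprime.
have e0 : (0 < e)%N by case: (posnP e) pe => // ->; rewrite dvdn0.
set j := logn p (M * N) in MNe.
have [w we] := exists_nth_root pi e0.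
have w0 : w != 0 by apply: contra_neq pi0 => w0; rewrite -we w0 expr0n eqn0Ngt e0.
have sw : s w = w by apply: sfix we.
have wk0 : w ^ (k * N) != 0 by rewrite expfz_neq0.
pose y := x ^+ (p ^ j) / w ^ (k * N).
have y0 : y != 0 by rewrite mulf_neq0 ?invr_neq0 ?expf_neq0.
have ye : y ^+ e = u ^+ N.
  rewrite /y /u !exprMn !exprVn -!exprM [(p ^ j * e)%N]mulnC -MNe; congr (_ / _).
  by rewrite -[in RHS]we !exprnP !exprz_exp; congr (w ^ _); ring.
have hy : vgt v (y ^+ e - 1) 0 by rewrite ye.
have vy : v y = 0.
  have : e%:R * v y = 0 by rewrite -valX// ye valX// vu mulr0.
  by move=> /eqP; rewrite mulf_eq0 pnatr_eq0 eqn0Ngt e0 => /eqP.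
have n0 : 'X^e - 1 != 0 :> {poly L}.
  by rewrite -size_poly_eq0 (size_XnsubC 1 e0).
have [rs rsE] := closed_field_poly_normal ('X^e - 1 : {poly L}).
move: rsE; rewrite (lead_coefXnsubC 1 e0) scale1r => rsE.
have rsu z : z \in rs -> z ^+ e = 1.
  rewrite -root_prod_XsubC -rsE rootE !hornerE subr_eq0 => /eqP //.
have [z zr hz] : exists2 z, z \in rs & vgt v (y - z) 0.
  apply: vgt_prod => // [z /rsu ze|].
    have z0 : z != 0 by apply: contra_eq_neq ze => ->; rewrite expr0n eqn0Ngt e0 eq_sym oner_eq0.
    have vz : v z = 0.
      have : e%:R * v z = 0 by rewrite -valX// ze val1.
      by move=> /eqP; rewrite mulf_eq0 pnatr_eq0 eqn0Ngt e0 => /eqP.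
    by apply: vgeB; rewrite // vgeE// ?vy ?vz.
  have := hy; rewrite -[y ^+ e - 1](_ : ('X^e - 1).[y] = _); last by rewrite !hornerE.
  rewrite rsE horner_prod; congr (vgt v _ _).
  by apply: eq_bigr => i _; rewrite !hornerE.
(* Both [w] and [z * w] are [e]-th roots of [pi], so [s] fixes them and hence their quotient. *)
have sz : s z = z.
  have : s (z * w) = z * w by apply: (sfix e) => //; rewrite exprMn (rsu z zr) mul1r.
  by rewrite ef rmorphM -ef sw => /(mulIf w0).
have sy : vgt v (s y / y - 1) 0.
  have h1 : vgt v (s y - z) 0.
    by have := hz; rewrite -(vgt_GK hK hv hc hA _ 0 sG) ef rmorphB -ef sz.
  have -> : s y / y - 1 = ((s y - z) - (y - z)) * y^-1.
    by rewrite opprB addrA subrK mulrBl divff.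
  by apply: vgtM0 => //; [apply: vgtB|rewrite vgeE ?invr_neq0// valV// vy oppr0].
have vq : vge v (s x / x) 0.
  by rewrite vgeE ?mulf_neq0 ?invr_neq0// valM ?invr_neq0// valV// (val_GK hK hv hc hA sG x0) subrr.
have : vgt v (s x / x - 1) 0.
  apply: (@frobenius_inj _ j) vq _.
  have -> : (s x / x) ^+ (p ^ j) = s y / y; last by [].
  have -> : s y = s x ^+ (p ^ j) / w ^ (k * N).
    rewrite /y -[in RHS]sw ef rmorphM fmorphV rmorphXn; congr (_ / _).
    exact: fmorphXz.
  by rewrite /y exprMn exprVn invfM invrK mulrACA mulVf// mulr1.
move=> h; have := vgtM hv h (vge_refl v x).
by rewrite mulrBl divfK// mul1r add0r.
Qed.

(** This plays the role of the maximal tame extension of [K]. The union over [e] is directed, as [e]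
    and [e'] are both dominated by [e * e'], so membership provides a single [e]. *)
Definition tame_closure : {pred L} := fun x => boolp.asbool (exists2 e, ~~ (p %| e)%N
  & forall s, GK K s -> (forall y, y ^+ e = pi -> s y = y) -> s x = x).

Lemma tame_closureP : divring_closed tame_closure /\ {subset K <= tame_closure}.
Proof.
have KT : {subset K <= tame_closure}.
  move=> k kK; apply/boolp.asboolP; exists 1%N.
    by rewrite dvdn1 neq_ltn prime_gt1// orbT.
  by move=> s sG _; apply: GK_fix sG kK.
have root_mul e e' s : GK K s -> ~~ (p %| e')%N ->
    (forall y, y ^+ (e * e') = pi -> s y = y) -> forall y, y ^+ e = pi -> s y = y.
  move=> /GK_rmorphism[f ->] pe' h y ye.
  have e'0 : (0 < e')%N by case: (posnP e') pe' => // ->; rewrite dvdn0.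
  have [z ze] := exists_nth_root y e'0.
  have sz : f z = z by apply: h; rewrite mulnC exprM ze.
  by rewrite -ze rmorphXn /= sz.
have closed2 (op : L -> L -> L) :
    (forall s x y, GK K s -> s x = x -> s y = y -> s (op x y) = op x y) ->
    forall x y, x \in tame_closure -> y \in tame_closure -> op x y \in tame_closure.
  move=> hop x y /boolp.asboolP[e pe hx] /boolp.asboolP[e' pe' hy].
  apply/boolp.asboolP; exists (e * e')%N; first by rewrite Euclid_dvdM// negb_or pe.
  move=> s sG hs; apply: hop => //; first by apply: hx => //; apply: (root_mul e e' s).
  by apply: hy => //; apply: (root_mul e' e s) => //; rewrite mulnC.
split=> //; split.
- exact/KT/rpred1.
- apply: (closed2 (fun x y => x - y)) => s x y /GK_rmorphism[f ->] hx hy.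
  by rewrite rmorphB hx hy.
- apply: (closed2 (fun x y => x / y)) => s x y /GK_rmorphism[f ->] hx hy.
  by rewrite rmorphM fmorphV hx hy.
Qed.

(** An automorphism over [tame_closure] fixes every [e]-th root of [pi] with [e] prime to [p], so it
    is wild and fixes [r]. Descent to the base [tame_closure] concludes. *)
Lemma tame_fixed (h : {poly L}) r : h \is a polyOver K -> separable_poly h ->
  root h r -> (forall s, wild_inertia K v s -> s r = r) -> r \in tame_closure.
Proof.
move=> /polyOverP hh hs hroot rfix; have [dT KT] := tame_closureP.
have T0 : 0 \in tame_closure by apply: KT; apply: rpred0.
have T1 : 1 \in tame_closure by apply: KT; apply: rpred1.
apply: (fixed_in_simple_ext hK hA dT KT (h := h) (Q := 'X) (a := r)) => //.
- by apply/polyOverP => i; apply: KT.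
- by apply/polyOverP => i; rewrite coefX; case: eqP.
- by rewrite hornerX.
- move=> s sG sT; apply/rfix/fix_roots_wild => // e y pe ye; apply: sT.
  by apply/boolp.asboolP; exists e => // t _; apply.
Qed.

End ResidueChar.
End Residue.

(** * Rational points of stable discs *)

Lemma perm_map_stable (T : eqType) (s : seq T) (f : T -> T) :
  uniq s -> injective f -> {homo f : x / x \in s} -> perm_eq (map f s) s.
Proof.
move=> us finj fs.
have sub : {subset map f s <= s} by move=> _ /mapP[x xs ->]; apply: fs.
have us' : uniq (map f s) by rewrite map_inj_uniq.
have [_ e] := uniq_min_size us' sub (eq_leq (esym (size_map f s))).
by apply: uniq_perm => // x; rewrite e.
Qed.

(** Multiplication by [w] permutes [W]; comparing the products of all elements gives
    [w ^+ size W = 1]. So [W] consists of all roots of unity of that order and contains a primitive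
    one, whose order divides [e]. *)
Lemma finite_mulgroup_size_dvd (F : fieldType) (W : seq F) e :
  (0 < size W)%N -> uniq W -> (forall w, w \in W -> w ^+ e = 1) -> (0 < e)%N ->
  (forall x y, x \in W -> y \in W -> x * y \in W) -> (size W %| e)%N.
Proof.
move=> W0 uW We e0 WM.
have Wn0 w : w \in W -> w != 0.
  by move=> /We; apply: contra_eq_neq => ->; rewrite expr0n eqn0Ngt e0 eq_sym oner_neq0.
have Wc w : w \in W -> w ^+ size W = 1.
  move=> wW; pose P := \prod_(x <- W) x.
  have P0 : P != 0 by rewrite prodf_seq_neq0; apply/allP => x xW; rewrite Wn0.
  have : \prod_(x <- [seq w * x | x <- W]) x = P.
    apply/perm_big/perm_map_stable => // [|x]; last exact: WM.
    exact/mulfI/Wn0.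
  rewrite big_map big_split /= -/P.
  rewrite big_const_seq count_predT iter_mulr_1 -[X in _ = X]mul1r.
  exact: mulIf.
have /hasP[x xW xp] : has (size W).-primitive_root W.
  apply: cyclic.has_prim_root => //; apply/allP => w wW.
  by apply/unity_rootP/Wc.
by rewrite (prim_order_dvd xp) We.
Qed.

Lemma separable_XnsubC (L : closedFieldType) n (a : L) :
  n%:R != 0 :> L -> a != 0 -> separable_poly ('X^n - a%:P).
Proof.
move=> n0 a0; rewrite separable_poly.unlock.
apply: Pdiv.ClosedField.root_coprimep => x.
rewrite rootE !hornerE subr_eq0 derivB derivXn derivC subr0 hornerMn hornerXn => /eqP xn.
rewrite -mulr_natl mulf_neq0// expf_neq0//; apply: contra_neq a0 => x0.
by rewrite -xn x0 expr0n; case: (n) n0 => // /eqP.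
Qed.

Section RationalPoint.
Variables (L : closedFieldType) (K : {pred L}) (v : L -> rat).
Hypotheses (hK : divring_closed K) (hA : K_algebraic_closure K).
Hypotheses (hv : is_valuation v) (hc : K_complete K v).
HB.instance Definition _ := GRing.isDivringClosed.Build L K hK.

(* A generator [pi] of the value group of [K], up to torsion; the value group
   of [K] may be trivial since a "uniformiser" [pi = 0] with junk value
   [v 0 = 1] is not excluded. *)
Lemma value_group_span : exists2 pi, pi \in K & pi != 0 /\
  forall x, x != 0 -> exists M (k : int), (0 < M)%N /\ M%:R * v x = k%:~R * v pi.
Proof.
have [[pi [piK [pi0 vpi]]]|none] := classic (exists pi, pi \in K /\ pi != 0 /\ v pi != 0).
  exists pi => //; split=> // x x0; pose q := v x / v pi.
  exists `|denq q|%N, (numq q); split; first by rewrite absz_gt0 denq_neq0.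
  have -> : v x = q * v pi by rewrite divfK.
  by rewrite mulrA pmulrn absz_denq [_ * q]mulrC -numqE.
have v0 k : k \in K -> k != 0 -> v k = 0.
  move=> kK k0; apply: NNPP => vk; apply: none; exists k; split=> //; split=> //.
  exact/eqP.
have vle0 x : x != 0 -> v x <= 0.
  move=> x0; rewrite leNgt; apply/negP => vx.
  have [Q /polyOverP QK xQ] := alg_inv hK hA x0.
  have : vge v x^-1 0.
    rewrite xQ horner_coef; apply: vge_sum => // i _; apply: vgeM0 => //.
      by have [->|q0] := eqVneq Q`_i 0; [exact: vge0|rewrite vgeE// v0].
    by apply: vgeX => //; rewrite vgeE// ltW.
  by rewrite vgeE ?invr_neq0// valV// oppr_ge0 leNgt vx.
exists 1; first exact: rpred1.
split=> [|x x0]; first exact: oner_neq0.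
exists 1%N, 0; split=> //; rewrite mul1r mul0r; apply/eqP.
by rewrite eq_le vle0//= -oppr_le0 -valV// vle0// invr_neq0.
Qed.

Variable p : nat.
Hypotheses (pP : prime p) (pE : forall n, vgt v n%:R 0 = (p %| n)%N).
Variable pi : L.
Hypotheses (piK : pi \in K) (pi0 : pi != 0).

(* Averaging the conjugates of [r], with weights the conjugates of [zeta ^+ i]
   for a primitive [e]-th root of unity [zeta], over the orbit [O] of the pair
   [(zeta, w)] with [w ^+ e = pi], which determines the conjugate of [r].  The
   total weight is a unit for some [i], because the weights [u i] satisfy
   [\sum_i zeta ^- i * u i = e * c] with [c] the size of the stabiliser of [zeta]
   in the orbit, a divisor of [e]. *)
Lemma tame_disc_rational r d h :
  h \is a polyOver K -> separable_poly h -> root h r ->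
  r \in tame_closure K p pi ->
  (forall s, GK K s -> vge v (s r - r) d) ->
  exists2 z, z \in K & vge v (z - r) d.
Proof.
move=> hhK hs hr /boolp.asboolP[e pe rfix] rd.
have e0 : (0 < e)%N by case: (posnP e) pe => // ->; rewrite dvdn0.
have eL0 : e%:R != 0 :> L.
  by apply: contra pe => /eqP e0'; rewrite -pE e0' vgt0.
have sep1 : separable_poly ('X^e - 1 : {poly L}) by apply: separable_Xn_sub_1.
have n1 : 'X^e - 1 != 0 :> {poly L} by rewrite -size_poly_eq0 (size_XnsubC 1 e0).
have nw : 'X^e - pi%:P != 0 :> {poly L} by rewrite -size_poly_eq0 size_XnsubC.
have [rs [urs rsE]] := roots_of n1; have [ws [uws wsE]] := roots_of nw.
have {}rsE z : (z \in rs) = (z ^+ e == 1).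
  by rewrite rsE rootE !hornerE subr_eq0.
have {}wsE z : (z \in ws) = (z ^+ e == pi).
  by rewrite wsE rootE !hornerE subr_eq0.
have srs : (e <= size rs)%N.
  have [q qE] := closed_field_poly_normal ('X^e - 1 : {poly L}).
  move: qE; rewrite (lead_coefXnsubC 1 e0) scale1r => qE.
  have uq : uniq q by rewrite -separable_prod_XsubC -qE.
  have : size ('X^e - 1 : {poly L}) = e.+1 by rewrite (size_XnsubC 1 e0).
  rewrite qE size_prod_XsubC => -[<-]; apply: uniq_leq_size => // x.
  by rewrite -root_prod_XsubC -qE rootE !hornerE subr_eq0 rsE.
have /hasP[zeta _ zP] : has e.-primitive_root rs.
  apply: cyclic.has_prim_root => //; apply/allP => x; rewrite rsE => /eqP.
  by move/unity_rootP.
have ze := prim_expr_order zP.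
have [w we] := exists_nth_root pi e0.
have w0 : w != 0 by apply: contra_neq pi0 => w0; rewrite -we w0 expr0n eqn0Ngt e0.
have root1 x : x ^+ e = 1 -> x != 0 /\ v x = 0.
  move=> xe; have x0 : x != 0.
    by apply: contra_eq_neq xe => ->; rewrite expr0n eqn0Ngt e0 eq_sym oner_neq0.
  split=> //; have : e%:R * v x = 0 by rewrite -valX// xe val1.
  by move=> /eqP; rewrite mulf_eq0 pnatr_eq0 eqn0Ngt e0 => /eqP.
have [z0 vz] := root1 _ ze.
have GKX s x n : GK K s -> s (x ^+ n) = s x ^+ n.
  by move=> /GK_rmorphism[f ->]; rewrite rmorphXn.
have GKM s x y : GK K s -> s (x * y) = s x * s y by case.
(* Every [e]-th root of [pi] is [w] times a power of [zeta], so an automorphism fixing [zeta] and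
   [w] fixes all of them, and [r] too. This makes [rho] below independent of the choice of [sg]. *)
have det s t : GK K s -> GK K t -> s zeta = t zeta -> s w = t w -> s r = t r.
  move=> sG tG sz sw; have [t' [t'G tt' t't]] := GK_inv tG.
  suff : t' (s r) = r by move/(congr1 t); rewrite t't.
  apply: (rfix (t' \o s) (GK_comp t'G sG)) => y ye /=.
  have : (y / w) ^+ e = 1 by rewrite exprMn exprVn ye we divff.
  case/(prim_rootP zP) => i /(canRL (divfK w0)) ->.
  by rewrite !GKM// !GKX// sz sw !tt'.
pose inO o := boolp.asbool (exists2 s, GK K s & o = (s zeta, s w)).
pose O := [seq o <- [seq (a, b) | a <- rs, b <- ws] | inO o].
have uO : uniq O.
  by apply: filter_uniq; apply: allpairs_uniq => // -[a b] [a' b'] _ _ /= ->.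
have OE o : reflect (exists2 s, GK K s & o = (s zeta, s w)) (o \in O).
  apply: (iffP idP); first by rewrite mem_filter => /andP[/boolp.asboolP].
  case=> s sG oE; rewrite mem_filter; apply/andP; split.
    by apply/boolp.asboolP; exists s.
  rewrite oE; apply/allpairsP; exists (s zeta, s w); split=> //=.
    by rewrite rsE -GKX// ze; case: sG => _ _ ->.
  by rewrite wsE -GKX// we (GK_fix sG piK).
have lift o : exists s, o \in O -> GK K s /\ o = (s zeta, s w).
  by have [/OE[s sG ->]|_] := boolP (o \in O); [exists s|exists id].
have [sg sgP] := choice _ lift.
pose rho o := sg o r.
pose act (s : L -> L) (o : L * L) := (s o.1, s o.2).
have actO s o : GK K s -> o \in O -> act s o \in O.
  move=> sG /OE[t tG ->]; apply/OE; exists (s \o t) => //.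
  exact: GK_comp.
have rhoE s : GK K s -> rho (s zeta, s w) = s r.
  move=> sG; have oO : (s zeta, s w) \in O by apply/OE; exists s.
  have [tG oE] := sgP _ oO.
  by apply: (det _ _ tG sG); [case: oE|case: oE].
have rhoA s o : GK K s -> o \in O -> s (rho o) = rho (act s o).
  move=> sG /OE[t tG ->]; rewrite rhoE// /act /=.
  by rewrite -[RHS]/(rho ((s \o t) zeta, (s \o t) w)) rhoE//; apply: GK_comp.
have permO s : GK K s -> perm_eq (map (act s) O) O.
  move=> sG; apply: perm_map_stable uO _ _ => [|o]; last exact: actO.
  have [t [_ st _]] := GK_inv sG.
  by move=> [a b] [a' b'] [/(congr1 t) + /(congr1 t)]; rewrite !st => -> ->.
have invar s (F : L * L -> L) : GK K s ->
    (forall o, o \in O -> s (F o) = F (act s o)) ->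
    s (\sum_(o <- O) F o) = \sum_(o <- O) F o.
  move=> sG hF; rewrite -[RHS](perm_big _ (permO s sG)) big_map.
  have [f ef] := GK_rmorphism sG; rewrite {1}ef rmorph_sum big_seq [RHS]big_seq -ef.
  exact: eq_bigr.
pose u i := \sum_(o <- O) o.1 ^+ i.
pose Z i := \sum_(o <- O) o.1 ^+ i * rho o.
have uinv s i : GK K s -> s (u i) = u i.
  by move=> sG; apply: invar => // o _; rewrite GKX.
have Zinv s i : GK K s -> s (Z i) = Z i.
  by move=> sG; apply: invar => // o oO; rewrite GKM// GKX// rhoA.
have O1 o : o \in O -> o.1 ^+ e = 1.
  by rewrite mem_filter => /andP[_ /allpairsP[[a b] [ars _ ->]]]; move: ars; rewrite rsE => /eqP.
pose H := [seq o <- O | o.1 == zeta].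
have cE : \sum_(i < e) zeta ^- i * u i = (e * size H)%:R.
  under eq_bigr => i _ do rewrite mulr_sumr.
  have -> : (e * size H)%:R = \sum_(o <- O) (if o.1 == zeta then e%:R else 0) :> L.
    rewrite -big_mkcond -[RHS]big_filter -/H.
    by rewrite big_const_seq count_predT iter_addr_0 mulrnA.
  rewrite exchange_big /=; apply: eq_big_seq => o oO /=.
  (* A geometric sum over an [e]-th root of unity [q] vanishes unless [q = 1]. *)
  pose q := zeta^-1 * o.1.
  under eq_bigr => i _ do rewrite -exprVn -exprMn -/q.
  have [o1|o1] := eqVneq o.1 zeta.
    rewrite /q o1 mulVf//; under eq_bigr => i _ do rewrite expr1n.
    by rewrite sumr_const card_ord.
  have qe : q ^+ e = 1 by rewrite exprMn exprVn ze O1// invr1 mulr1.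
  have q1 : q - 1 != 0.
    rewrite subr_eq0; apply: contra o1 => /eqP q1.
    by rewrite -[o.1](mulVKf z0) -/q q1 mulr1.
  by apply: (mulfI q1); rewrite mulr0 -subrX1 qe subrr.
have He : (size H %| e)%N.
  (* Kummer theory: for [s] fixing [zeta], the ratio [s w / w] is a power of [zeta], hence fixed by
     the stabiliser of [zeta]; so such ratios multiply as the automorphisms compose. *)
  pose W := [seq o.2 / w | o <- H].
  have WE x : reflect (exists s, [/\ GK K s, s zeta = zeta & x = s w / w]) (x \in W).
    apply: (iffP mapP) => [[o]|[s [sG sz ->]]].
      by rewrite mem_filter => /andP[/eqP o1 /OE[s sG oE]] ->; exists s; move: o1; rewrite oE.
    exists (s zeta, s w) => //; rewrite mem_filter /= sz eqxx /=.
    by apply/OE; exists s; rewrite ?sz.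
  have -> : size H = size W by rewrite size_map.
  have We x : x \in W -> x ^+ e = 1.
    by case/WE => s [sG _ ->]; rewrite exprMn exprVn -GKX// we (GK_fix sG piK) divff.
  apply: finite_mulgroup_size_dvd => //.
  - suff : 1 \in W by case: (W).
    by apply/WE; exists id; split=> //; [exact: GK_id|rewrite divff].
  - rewrite map_inj_in_uniq; first exact: filter_uniq uO.
    move=> [a b] [a' b']; rewrite mem_filter /= => /andP[/eqP -> _].
    rewrite mem_filter /= => /andP[/eqP -> _].
    by move/(mulIf (invr_neq0 w0)) => ->.
  - move=> x y xW /WE[t [tG tz ->]]; have [i xi] := prim_rootP zP (We _ xW).
    have tx : t x = x by rewrite xi GKX// tz.
    have /WE[s [sG sz xE]] := xW.
    apply/WE; exists (t \o s); split; [exact: GK_comp|by rewrite /= sz tz|].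
    by rewrite /= -[s w](divfK w0) -xE (GKM t)// tx mulrA.
have u0 i : vge v (u i) 0.
  rewrite /u big_seq; apply: vge_sum => // o oO; apply: vgeX => //.
  by have [a0 va] := root1 _ (O1 _ oO); rewrite vgeE// va.
have [i ui] : exists i, ~~ vgt v (u i) 0.
  apply: NNPP => none.
  have hu i : vgt v (u i) 0 by apply: NNPP => hu; apply: none; exists i; apply/negP.
  have : vgt v (e * size H)%:R 0.
    rewrite -cE; apply: vgt_sum => // i _; apply: vgtMl0 => //.
    by rewrite vgeE ?invr_neq0 ?expf_neq0// valV ?expf_neq0// valX// vz mulr0 oppr0.
  rewrite pE Euclid_dvdM// => /orP[|h']; first by rewrite (negPf pe).
  by move: pe; rewrite (dvdn_trans h' He).
have [hgt|[ui0 vui]] := vgeP (u0 i); first by rewrite hgt in ui.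
exists (Z i / u i).
  (* The quotient is invariant and is built from roots of the separable polynomials ['X^e - 1],
     ['X^e - pi%:P] and [h]. *)
  apply: (fixed_in_base hK hA (A := rs ++ ws ++ [seq rho o | o <- O])).
  - move=> a; rewrite !mem_cat => /or3P[].
    + rewrite rsE => /eqP ae; exists ('X^e - 1); split=> //.
        by rewrite rpredB ?rpredX ?polyOverX ?rpred1.
      by rewrite rootE !hornerE ae subrr.
    + rewrite wsE => /eqP ae; exists ('X^e - pi%:P); split.
      * by rewrite rpredB ?rpredX ?polyOverX ?polyOverC.
      * exact: separable_XnsubC.
      * by rewrite rootE !hornerE ae subrr.
    + case/mapP => o oO ->; exists h; split=> //.
      by have [tG _] := sgP _ oO; apply: (GK_root hK tG).
  - have [dA KA AA] := adjoin_seqP hK hA (rs ++ ws ++ [seq rho o | o <- O]).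
    set T := adjoin_seq _ _ in dA KA AA *.
    pose T' : divringClosed L := HB.pack T (GRing.isDivringClosed.Build L T dA).
    have o1T o : o \in O -> o.1 \in T'.
      by move=> oO; apply: AA; rewrite mem_cat rsE O1 ?eqxx.
    have rhT o : o \in O -> rho o \in T'.
      by move=> oO; apply: AA; rewrite !mem_cat map_f ?orbT.
    suff : Z i / u i \in T' by [].
    apply: rpred_div; rewrite /Z /u big_seq; apply: rpred_sum => o oO.
      by rewrite rpredM ?rpredX ?o1T ?rhT.
    by rewrite rpredX ?o1T.
  - move=> s sG; have := (Zinv s i sG, uinv s i sG).
    by have [f ->] := GK_rmorphism sG => -[hZ hu]; rewrite rmorphM fmorphV hZ hu.
have -> : Z i / u i - r = (\sum_(o <- O) o.1 ^+ i * (rho o - r)) / u i.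
  under [in RHS]eq_bigr => o _ do rewrite mulrBr.
  by rewrite sumrB -mulr_suml mulrBl [u i * r]mulrC mulfK.
rewrite -[d]addr0; apply: vgeM => //; last by rewrite vgeE ?invr_neq0// valV// vui oppr0.
rewrite big_seq; apply: vge_sum => // o oO; rewrite -[d]add0r; apply: vgeM => //.
  by apply: vgeX => //; have [a0 va] := root1 _ (O1 _ oO); rewrite vgeE// va.
by have [tG _] := sgP _ oO; exact: (rd _ tG).
Qed.

End RationalPoint.

(** * Gauss norms and clusters *)

Section Gauss.
Variables (L : closedFieldType) (v : L -> rat).
Hypothesis hv : is_valuation v.

Lemma coef_XsubC_mul (r : L) (P : {poly L}) i :
  (('X - r%:P) * P)`_i = (if i is j.+1 then P`_j else 0) - r * P`_i.
Proof. by rewrite mulrBl coefB coefXM coefCM; case: i. Qed.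

Lemma prod_XsubC_vge (m : L -> rat) (rs : seq L) :
  (forall r, r \in rs -> m r <= 0 /\ vge v r (m r)) ->
  forall i, vge v (\prod_(r <- rs) ('X - r%:P))`_i (\sum_(r <- rs) m r).
Proof.
elim: rs => [|r rs IH] hm i.
  by rewrite !big_nil coef1; case: eqP => _; [exact: vge1|exact: vge0].
have [m0 mr] := hm r (mem_head r rs).
have {}IH := IH (fun x xr => hm x (mem_behead (s := r :: rs) xr)).
rewrite !big_cons coef_XsubC_mul; apply: vgeB => //; last exact: vgeM.
case: i => [|i]; first exact: vge0.
by apply: vge_le (IH i); rewrite gerDr.
Qed.

(* [min (v r) 0], with [v 0] read as [+oo]. *)
Definition val0 (r : L) : rat := if vge v r 0 then 0 else v r.

Lemma val0_le0 r : val0 r <= 0.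
Proof.
rewrite /val0; case: ifP => [_|]; first exact: lexx.
by rewrite /vge; case: eqP => //= _; case: leP => // lt _; apply: ltW.
Qed.

Lemma vge_val0 d r : d <= 0 -> vge v r d = (d <= val0 r).
Proof.
move=> d0; rewrite /val0; case: ifP => h; first by rewrite d0 (vge_le d0 h).
by move: h; rewrite /vge; case: eqP.
Qed.

Lemma vge_val0_self r : vge v r (val0 r).
Proof. by rewrite vge_val0 ?val0_le0. Qed.

Lemma val0_lt0 r : val0 r < 0 -> r != 0 /\ v r = val0 r.
Proof.
by rewrite /val0 /vge; case: eqP => //= _; case: ifP => // _; rewrite ltxx.
Qed.

Lemma val_sub_val0 x y : val0 x < val0 y -> x - y != 0 /\ v (x - y) = val0 x.
Proof.
move=> xy; have x0 : val0 x < 0 by apply: lt_le_trans xy (val0_le0 y).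
have [xn0 vx] := val0_lt0 x0; rewrite -vx; apply: valD_gt => //.
by rewrite vgtN// vx; apply: vge_vgt xy (vge_val0_self y).
Qed.

(* The Gauss norm of a product of linear factors is attained: at the next
   coefficient after the last extremal one when [r] is integral, at any extremal
   one otherwise. *)
Lemma prod_XsubC_val (rs : seq L) : exists i,
  (\prod_(r <- rs) ('X - r%:P))`_i != 0 /\
  v (\prod_(r <- rs) ('X - r%:P))`_i = \sum_(r <- rs) val0 r.
Proof.
elim: rs => [|r rs [i0 [Pi0 vi0]]].
  by exists 0%N; rewrite !big_nil coef1 eqxx oner_neq0 val1.
set P := \prod_(r <- rs) _ in Pi0 vi0; set S := \sum_(r <- rs) _ in vi0.
have PS i : vge v P`_i S.
  by apply: prod_XsubC_vge => x _; rewrite val0_le0 vge_val0_self.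
rewrite !big_cons -/P -/S; have [r0|r0] := boolP (vge v r 0).
  have ub i : (P`_i != 0) && (v P`_i == S) -> (i <= size P)%N.
    by case/andP => h _; rewrite ltnW// ltnNge; apply: contra h => /(nth_default 0) ->.
  have ex : exists i, (P`_i != 0) && (v P`_i == S).
    by exists i0; rewrite Pi0 vi0 eqxx.
  case: (ex_maxnP ex ub) => i /andP[Pi /eqP vi] imax.
  exists i.+1; rewrite coef_XsubC_mul [val0 r]/val0 r0 add0r -vi.
  apply: valD_gt => //; rewrite vgtN// mulrC -[v _]addr0 vi; apply: vgtM => //.
  have [//|[h1 h2]] := vgeP (PS i.+1).
  by have := imax i.+1; rewrite h1 h2 eqxx ltnn => /(_ isT).
have rn0 : r != 0 by apply: contraNneq r0 => ->; rewrite vge0.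
have vr : val0 r = v r by rewrite /val0 (negPf r0).
have r0' : v r < 0 by move: r0; rewrite vgeE// ltNge.
exists i0; rewrite coef_XsubC_mul addrC vr -vi0.
have e : v (- (r * P`_i0)) = v r + v P`_i0 by rewrite valN ?mulf_neq0// valM.
rewrite -e; apply: (valD_gt hv); first by rewrite oppr_eq0 mulf_neq0.
rewrite e vi0; case: (i0) => [|j]; first exact: vgt0.
by apply: vge_vgt (PS j); rewrite gtrDr.
Qed.

End Gauss.

Section Clusters.
Variables (L : closedFieldType) (v : L -> rat) (R : {fset L}).
Hypothesis hv : is_valuation v.

Lemma foldr_min_le (vs : seq rat) a x : x \in vs -> foldr Num.min a vs <= x.
Proof.
elim: vs => //= y vs IH; rewrite inE => /orP[/eqP ->|/IH h].
  by rewrite ge_min lexx.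
by rewrite ge_min h orbT.
Qed.

Lemma foldr_min_mem (vs : seq rat) a : foldr Num.min a vs \in a :: vs.
Proof.
elim: vs => /= [|y vs IH]; first by rewrite mem_head.
rewrite minEle; case: ifP => _; first by rewrite !inE eqxx orbT.
by move: IH; rewrite !inE => /orP[->|->]; rewrite ?orbT.
Qed.

Lemma depth_le (s : {fset L}) x y : x \in s -> y \in s -> x != y ->
  depth v s <= v (x - y).
Proof.
move=> xs ys xy; apply: foldr_min_le; apply/mapP; exists (x, y) => //=.
by rewrite mem_filter /= xy; apply/allpairsP; exists (x, y).
Qed.

Lemma vge_depth (s : {fset L}) x y : x \in s -> y \in s ->
  vge v (x - y) (depth v s).
Proof.
move=> xs ys; have [->|xy] := eqVneq x y; first by rewrite subrr vge0.
by rewrite vgeE ?subr_eq0// depth_le.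
Qed.

Lemma depth_attained (s : {fset L}) : Defs.proper s ->
  exists x y, [/\ x \in s, y \in s, x != y & depth v s = v (x - y)].
Proof.
rewrite /Defs.proper => s1; rewrite /depth; set vs := map _ _.
have vsP d : d \in vs ->
    exists x y, [/\ x \in s, y \in s, x != y & d = v (x - y)].
  case/mapP => -[x y]; rewrite mem_filter /= => /andP[xy /allpairsP[[a b]]].
  by move=> [/= aS bS [ex ey]] ->; subst; exists a, b.
have vs0 : vs != [::].
  have [x xs] : exists x, x \in s.
    by apply/fset0Pn; rewrite -cardfs_gt0 (ltn_trans _ s1).
  have [y] : exists y, y \in (s `\ x)%fset.
    by apply/fset0Pn; rewrite -cardfs_gt0; move: s1; rewrite (cardfsD1 x) xs add1n ltnS.
  rewrite !inE => /andP[yx ys].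
  suff : v (y - x) \in vs by case: (vs).
  apply/mapP; exists (y, x) => //; rewrite mem_filter /= yx.
  by apply/allpairsP; exists (y, x).
apply: vsP; case: (vs) vs0 => //= a l _.
have := foldr_min_mem l a; rewrite !inE minEle.
by case: ifP => _; rewrite ?eqxx.
Qed.

Lemma le_depth (s : {fset L}) d : Defs.proper s ->
  (forall x y, x \in s -> y \in s -> vge v (x - y) d) -> d <= depth v s.
Proof.
move=> sp h; have [x [y [xs ys xy ->]]] := depth_attained sp.
by have := h x y xs ys; rewrite vgeE ?subr_eq0.
Qed.

Lemma proper_of_neq (s : {fset L}) x y : x \in s -> y \in s -> x != y -> Defs.proper s.
Proof.
move=> xs ys xy; rewrite /Defs.proper (cardfsD1 x) xs add1n ltnS cardfs_gt0.
by apply/fset0Pn; exists y; rewrite !inE eq_sym xy.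
Qed.

Lemma disc_mem z d x :
  (x \in [fset x in R | in_disc v z d x]%fset) = (x \in R) && vge v (x - z) d.
Proof. by rewrite !inE. Qed.

Lemma cluster_sub s : is_cluster v R s -> {subset s <= R}.
Proof. by case=> _ [z [d ->]] x; rewrite disc_mem => /andP[]. Qed.

Lemma cluster_vge s z d x y : s = [fset x in R | in_disc v z d x]%fset ->
  x \in s -> y \in s -> vge v (x - y) d.
Proof.
move=> ->; rewrite !disc_mem => /andP[_ xz] /andP[_ yz].
have -> : x - y = (x - z) - (y - z) by rewrite opprB addrA subrK.
exact: vgeB.
Qed.

(** The witness is the disc around [r] whose radius is the depth of [u], the set [s] with [r] added.
    A cluster containing [u] is cut out by a disc of radius at most that depth, so it contains the
    witness. *)
Lemma wedgeP r s : is_cluster v R s -> r \in R -> r \notin s ->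
  [/\ is_cluster v R (wedge v R r s), r \in wedge v R r s,
      {subset s <= wedge v R r s}
    & forall c, is_cluster v R c -> r \in c -> {subset s <= c} ->
      {subset wedge v R r s <= c}].
Proof.
move=> cs rR rs; pose u := (r |` s)%fset.
have ru : r \in u by rewrite !inE eqxx.
have su x : x \in s -> x \in u by rewrite !inE => ->; rewrite orbT.
have up : Defs.proper u.
  have [/fset0Pn[x xs] _] := cs.
  by apply: (proper_of_neq ru (su x xs)); apply: contraNneq rs => ->.
have uR x : x \in u -> x \in R.
  by rewrite !inE => /orP[/eqP -> //|]; apply: cluster_sub.
pose c := [fset x in R | in_disc v r (depth v u) x]%fset.
have uc x : x \in u -> x \in c.
  by move=> xu; rewrite disc_mem uR//= vge_depth.
have ex : exists c, [/\ is_cluster v R c, r \in c, (s `<=` c)%fset &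
    forall c', is_cluster v R c' -> r \in c' -> (s `<=` c')%fset -> (c `<=` c')%fset].
  exists c; split.
  - by split; [apply/fset0Pn; exists r; apply: uc|exists r, (depth v u)].
  - exact: uc.
  - by apply/fsubsetP => x xs; apply/uc/su.
  - move=> c' [_ [z [d c'E]]] rc' /fsubsetP sc'; apply/fsubsetP => x.
    rewrite disc_mem => /andP[xR xr].
    have uc' y : y \in u -> y \in c' by rewrite !inE => /orP[/eqP -> //|/sc'].
    have du : d <= depth v u.
      by apply: le_depth => // a b au bu; apply: (cluster_vge c'E); apply: uc'.
    move: rc'; rewrite c'E !disc_mem xR => /andP[_ rz].
    have -> : x - z = (x - r) + (r - z) by rewrite addrA subrK.
    by apply: vgeD => //; apply: vge_le du xr.
have [h1 h2 /fsubsetP h3 h4] := epsilon_spec (inhabits fset0) _ ex.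
by split=> // c' cc rc sc; apply/fsubsetP/h4 => //; apply/fsubsetP.
Qed.

Lemma sum_fsubset (s t : {fset L}) (F : L -> rat) : {subset t <= s} ->
  \sum_(r <- enum_fset s | r \in t) F r = \sum_(r <- enum_fset t) F r.
Proof.
move=> ts; rewrite -big_filter; apply: perm_big; apply: uniq_perm.
- exact/filter_uniq/fset_uniq.
- exact: fset_uniq.
by move=> x; rewrite mem_filter; case: (boolP (x \in t)) => //= /ts.
Qed.

(** With [D] the depth of [s] and [W r] that of the wedge, the right side is the expression in
    [integral]. Rewriting it as one sum over [R] permits a root-by-root comparison with the Gauss
    norm, in both directions. *)
Lemma cluster_sum (s t : {fset L}) D (W : L -> rat) :
  {subset t <= s} -> {subset s <= R} ->
  \sum_(r <- enum_fset R)
     (if r \in t then 0 else if r \in s then D else W r) =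
  (#|` s|%:R - #|` t|%:R) * D + \sum_(r <- enum_fset R | r \notin s) W r.
Proof.
move=> ts sR; rewrite (bigID (fun r => r \in s)) /=; congr (_ + _); last first.
  apply: eq_bigr => r rs; rewrite (negPf rs).
  by case: ifP => // /ts rs'; rewrite rs' in rs.
rewrite sum_fsubset//.
have -> : \sum_(r <- enum_fset s) (if r \in t then 0 else if r \in s then D else W r) =
    \sum_(r <- enum_fset s) D - \sum_(r <- enum_fset s) (if r \in t then D else 0).
  rewrite -sumrB; apply: eq_big_seq => r rs.
  by case: ifP => _; rewrite ?subrr// rs subr0.
rewrite -big_mkcond sum_fsubset// !big_const_seq !count_predT !iter_addr_0.
by rewrite mulrBl !mulr_natl.
Qed.

End Clusters.

Lemma seq_argmax (T : eqType) (s : seq T) (F : T -> rat) x0 : x0 \in s ->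
  exists2 x, x \in s & forall y, y \in s -> F y <= F x.
Proof.
elim: s x0 => // a s IH x0 _; case: s IH => [|b s] IH.
  by exists a; rewrite ?mem_head// => y; rewrite inE => /eqP ->.
have [x xs xmax] := IH b (mem_head b s).
have [le|lt] := leP (F x) (F a).
  exists a; first exact: mem_head.
  by move=> y; rewrite inE => /orP[/eqP -> //|/xmax h]; apply: le_trans h le.
exists x; first by rewrite inE xs orbT.
by move=> y; rewrite inE => /orP[/eqP ->|/xmax //]; apply: ltW.
Qed.

(** * Integrality *)

Section Integrality.
Variables (L : closedFieldType) (K : {pred L}) (v : L -> rat).
Variables (f : {poly L}) (R : {fset L}).
Hypotheses (hK : divring_closed K) (hA : K_algebraic_closure K).
Hypotheses (hv : is_valuation v) (hc : K_complete K v).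
Hypotheses (fK : f \is a polyOver K) (fs : separable_poly f).
Hypothesis fR : forall x, (x \in R) = root f x.
HB.instance Definition _ := GRing.isDivringClosed.Build L K hK.

Let f0 : f != 0. Proof. exact: separable_poly_neq0. Qed.
Let lf0 : lead_coef f != 0. Proof. by rewrite lead_coef_eq0. Qed.

Lemma poly_prod_roots : f = lead_coef f *: \prod_(r <- enum_fset R) ('X - r%:P).
Proof.
have [q qE] := closed_field_poly_normal f.
rewrite {1}qE; congr (_ *: _); apply/perm_big/uniq_perm; last 1 first.
- by move=> x; rewrite -[RHS]/(x \in R) fR qE rootZ// root_prod_XsubC.
- rewrite -separable_prod_XsubC; apply: dvdp_separable fs.
  by rewrite [X in _ %| X]qE dvdpZr.
- exact: fset_uniq.
Qed.

Lemma card_roots : size f = #|` R|.+1.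
Proof. by rewrite {1}poly_prod_roots size_scale// size_prod_XsubC. Qed.

Lemma polyOver_OK (P : {poly L}) :
  reflect (forall i, P`_i \in OK K v) (P \is a polyOver (OK K v)).
Proof.
apply: (iffP (all_nthP 0)) => [h i|h i _]; last exact: h.
have [/h //|le] := ltnP i (size P).
by rewrite nth_default//; apply/OKP; rewrite rpred0 vge0.
Qed.

Lemma comp_roots z : f \Po ('X - z%:P) =
  lead_coef f *: \prod_(r <- [seq r + z | r <- enum_fset R]) ('X - r%:P).
Proof.
rewrite {1}poly_prod_roots comp_polyZ rmorph_prod big_map; congr (_ *: _).
apply: eq_bigr => r _.
by rewrite /= comp_polyB comp_polyX comp_polyC polyCD opprD [- r%:P - _]addrC addrA.
Qed.

Lemma integral_shift z (m : L -> rat) : z \in K ->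
  (forall r, r \in R -> m r <= 0 /\ vge v (r - z) (m r)) ->
  0 <= v (lead_coef f) + \sum_(r <- enum_fset R) m r ->
  f \Po ('X - (- z)%:P) \is a polyOver (OK K v).
Proof.
move=> zK hm h; apply/polyOver_OK => i; apply/OKP; split.
  have : f \Po ('X - (- z)%:P) \is a polyOver K.
    by apply: polyOver_comp => //; rewrite rpredB ?polyOverX// polyOverC rpredN.
  by move/polyOverP; apply.
rewrite comp_roots coefZ; apply: vge_le h _; apply: vgeM (vge_refl _ _) _ => //.
have -> : \sum_(r <- enum_fset R) m r =
    \sum_(r <- [seq r + - z | r <- enum_fset R]) m (r + z).
  by rewrite big_map; apply: eq_bigr => r _; rewrite subrK.
apply: (@prod_XsubC_vge _ _ hv (fun r => m (r + z))).
by move=> _ /mapP[r rR ->]; rewrite subrK; apply: hm.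
Qed.

Lemma GK_roots s x : GK K s -> x \in R -> s x \in R.
Proof. by move=> sG; rewrite !fR; apply: (GK_root hK sG). Qed.

Lemma stable_disc d : stable K [fset x in R | in_disc v 0 d x]%fset.
Proof.
have sub s x : GK K s -> x \in [fset x in R | in_disc v 0 d x]%fset ->
    s x \in [fset x in R | in_disc v 0 d x]%fset.
  move=> sG; rewrite !disc_mem !subr0 => /andP[xR xd].
  by rewrite GK_roots//= (vge_GK hK hv hc hA).
move=> s sG; apply/fsetP => y; apply/imfsetP/idP => /= [[x xD ->]|yD].
  exact: sub.
have [t [tG st ts]] := GK_inv sG.
by exists (t y); rewrite ?ts//; apply: sub.
Qed.

Lemma integral_of_OK n : v (lead_coef f) = n%:~R -> (1 < #|` R|)%N ->
  f \is a polyOver (OK K v) -> integral K v R n.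
Proof.
move=> vn Rp /polyOver_OK fO.
pose mu := val0 v.
have gauss : 0 <= n%:~R + \sum_(r <- enum_fset R) mu r.
  have [i [Pi vi]] := prod_XsubC_val hv (enum_fset R).
  have /OKP[_] := fO i; rewrite {1}poly_prod_roots coefZ vgeE ?mulf_neq0//.
  by rewrite valM// vi vn.
have summu : \sum_(r <- enum_fset R) mu r <= 0.
  by apply: sumr_le0 => r _; apply: val0_le0.
have n0 : 0 <= n by rewrite -(ler0z rat); lra.
have [dR|dR] := leP 0 (depth v R); first by left.
right.
have [x0 x0R] : exists x, x \in R by apply/fset0Pn; rewrite -cardfs_gt0 ltnW.
pose D d := [fset x in R | in_disc v 0 d x]%fset.
have DE d x : d <= 0 -> (x \in D d) = (x \in R) && (d <= mu x).
  by move=> d0; rewrite disc_mem subr0 (vge_val0 v x d0).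
have Dvge d x y : x \in D d -> y \in D d -> vge v (x - y) d.
  exact: (cluster_vge hv erefl).
have Dclus d x : x \in D d -> is_cluster v R (D d).
  by move=> xD; split; [apply/fset0Pn; exists x|exists 0, d].
have DR d : {subset D d <= R} by move=> x; rewrite disc_mem => /andP[].
have [r0 r0R r0max] := seq_argmax mu x0R.
pose m := mu r0; have m0 : m <= 0 by apply: val0_le0.
pose t := D m.
have r0t : r0 \in t by rewrite DE// r0R lexx.
(* [D (mu r)] is a cluster containing both [r] and [D d], so it contains their wedge, and the wedge
   is at least as deep as its radius. *)
have wedge_mu d r x : d <= 0 -> x \in D d -> r \in R -> r \notin D d ->
    mu r <= depth v (wedge v R r (D d)).
  move=> d0 xD rR rD; have rd : mu r < d by move: rD; rewrite DE// rR /= -ltNge.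
  have rm : mu r <= 0 by apply: val0_le0.
  have [wc rw sw wmin] := wedgeP hv (Dclus _ _ xD) rR rD.
  have rDr : r \in D (mu r) by rewrite DE// rR lexx.
  have sub : {subset wedge v R r (D d) <= D (mu r)}.
    apply: wmin => //; first exact: Dclus rDr.
    by move=> y; rewrite !DE// => /andP[-> /=]; apply: le_trans (ltW rd).
  apply: le_depth => [|y z /sub yw /sub zw]; last exact: Dvge.
  by apply: (proper_of_neq rw (sw _ xD)); apply: contraNneq rD => ->.
have bound s u : {subset u <= s} -> {subset s <= R} ->
    (forall r, r \in s -> r \notin u -> mu r <= depth v s) ->
    (forall r, r \in R -> r \notin s -> mu r <= depth v (wedge v R r s)) ->
    0 <= n%:~R + ((#|` s|)%:R - (#|` u|)%:R) * depth v s
      + \sum_(r <- enum_fset R | r \notin s) depth v (wedge v R r s).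
  move=> us sR hs hw; rewrite -addrA -(cluster_sum _ _ us sR).
  apply: le_trans gauss _; rewrite lerD2l big_seq [leRHS]big_seq.
  apply: ler_sum => r rR; case: ifPn => ru; first exact: val0_le0.
  by case: ifPn => rs; [apply: hs|apply: hw].
have [/andP[tp td]|tn] := boolP (Defs.proper t && (depth v t < 0)).
  exists t; split=> //; [exact: Dclus r0t|exact: stable_disc|exact: ltW|].
  exists fset0; split; first by left.
  apply: bound => //; first exact: DR.
    move=> r rt _; apply: (@le_trans _ _ m); first by apply/r0max/(DR m).
    by apply: le_depth => // x y; apply: Dvge.
  by move=> r rR rt; apply: (wedge_mu m r r0).
have t1 : #|` t| = 1%N \/ 0 <= depth v t.
  move: tn; rewrite negb_and -leNgt => /orP[|]; last by right.
  rewrite /Defs.proper -leqNgt => t1; left; apply/eqP; rewrite eqn_leq t1 cardfs_gt0.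
  by apply/fset0Pn; exists r0.
(* If [t] were all of [R], then [t1] would contradict either [Rp] or the negative depth of [R]. *)
have [x1 x1R x1t] : exists2 x, x \in R & x \notin t.
  apply: NNPP => none; have tR : t = R.
    apply/fsetP => x; apply/idP/idP => [|xR]; first exact: DR.
    by apply: NNPP => /negP xt; apply: none; exists x.
  rewrite tR in t1; case: t1 => [c1|]; first by rewrite c1 in Rp.
  by rewrite leNgt dR.
have [r1 r1B r1max] : exists2 x, x \in [seq x <- enum_fset R | x \notin t] &
    forall y, y \in [seq x <- enum_fset R | x \notin t] -> mu y <= mu x.
  by apply: (@seq_argmax _ _ mu x1); rewrite mem_filter x1t.
have /andP[r1t r1R] : (r1 \notin t) && (r1 \in R) by rewrite mem_filter in r1B.
pose m' := mu r1.
have m'm : m' < m by move: r1t; rewrite DE// r1R /= -ltNge.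
have m'0 : m' <= 0 by apply: val0_le0.
pose s := D m'.
have r1s : r1 \in s by rewrite DE// r1R lexx.
have ts : {subset t <= s}.
  by move=> x; rewrite !DE// => /andP[-> /=]; apply: le_trans (ltW m'm).
(* The value [m'] is the second largest level of [mu], so a root of [s] outside [t] lies exactly at
   that level, and strictly below [r0]. *)
have v10 x : x \in R -> x \notin t -> x \in s -> v (x - r0) = m'.
  move=> xR xt; rewrite DE// xR /= => m'x.
  have xm : mu x = m'.
    by apply/eqP; rewrite eq_le m'x andbT; apply: r1max; rewrite mem_filter xt.
  by have [_ ->] := @val_sub_val0 _ v hv x r0 (ltac:(by rewrite -/(mu x) xm)).
have r10 : r1 != r0 by apply: contraNneq r1t => ->.
have sp : Defs.proper s := proper_of_neq r1s (ts _ r0t) r10.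
have sd : depth v s = m'.
  apply/eqP; rewrite eq_le; apply/andP; split.
    by rewrite -(v10 r1 r1R r1t r1s) depth_le// ts.
  by apply: le_depth => // x y; apply: Dvge.
exists s; split; [exact: Dclus r1s|exact: sp|exact: stable_disc|by rewrite sd|].
exists t; split; last first.
  apply: bound => //; first exact: DR.
    move=> r rs rt; rewrite sd; apply: r1max; rewrite mem_filter rt.
    exact: DR rs.
  by move=> r rR rt; apply: (wedge_mu m' r r1).
right; split=> //; last exact: stable_disc; split.
- exact: Dclus r0t.
- rewrite fproperEneq; apply/andP; split; last exact/fsubsetP.
  by apply: contraNneq r1t => ->.
move=> c [_ [z [d cE]]].
rewrite fproperE => /andP[/fsubsetP tc /fsubsetPn[x xc xt]] /fsubsetP cs.
apply/fsetP => y; apply/idP/idP => [|ys]; first exact: cs.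
have xs := cs _ xc; have r0c := tc _ r0t.
have xr0 : x - r0 != 0.
  by rewrite subr_eq0; apply: contraNneq xt => ->.
(* A cluster strictly larger than [t] contains [r0] and a root at distance exactly [m'], so its disc
   already contains [s]; hence [t] is a child of [s]. *)
have dm : d <= m'.
  rewrite -(v10 x (DR _ _ xs) xt xs) -vgeE//.
  exact: (cluster_vge hv cE).
rewrite cE disc_mem (DR _ _ ys) /=.
have -> : y - z = (y - r0) + (r0 - z) by rewrite addrA subrK.
apply: vgeD => //; first by apply: vge_le dm _; apply: Dvge => //; apply: ts.
by move: r0c; rewrite cE disc_mem => /andP[].
Qed.

Hypothesis hr : finite_residue_field K v.
Hypothesis tame : tame_on_R K v R.

(** Stability keeps the conjugates of one root [r0] inside [s], hence within [d] of [r0]; this is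
    the input of [tame_disc_rational]. *)
Lemma stable_set_center (s : {fset L}) d : s != fset0 -> {subset s <= R} ->
  stable K s -> (forall x y, x \in s -> y \in s -> vge v (x - y) d) ->
  exists2 z, z \in K & forall r, r \in s -> vge v (r - z) d.
Proof.
move=> /fset0Pn[r0 r0s] sR st sd.
have [pi piK [pi0 pispan]] := value_group_span hK hA hv.
have [p pP pE] := residue_char hK hv hr.
have rf : root f r0 by rewrite -fR sR.
have r0T : r0 \in tame_closure K p pi.
  apply: (tame_fixed hK hA hv hr pP pE hc pi0 pispan fK fs rf) => s' hs'.
  by apply: tame => //; apply: sR.
have [|z zK hz] := tame_disc_rational hK hA hv pP pE piK pi0 fK fs rf r0T (d := d).
  move=> sg sgG; apply: sd => //.
  by rewrite -[X in _ \in X](st sg sgG); apply/imfsetP; exists r0.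
exists z => // r rs; have -> : r - z = (r - r0) - (z - r0) by rewrite opprB addrA subrK.
by apply: vgeB => //; apply: sd.
Qed.

Lemma OK_of_integral n : v (lead_coef f) = n%:~R -> (1 < #|` R|)%N ->
  integral K v R n -> exists2 z, z \in K & f \Po ('X - z%:P) \is a polyOver (OK K v).
Proof.
move=> vn Rp.
have stR : stable K R.
  move=> s sG; apply/fsetP => y; apply/imfsetP/idP => /= [[x xD ->]|yD].
    exact: GK_roots.
  have [t [tG st ts]] := GK_inv sG.
  by exists (t y); rewrite ?ts//; apply: GK_roots.
case=> [[n0 dR]|[s [sc sp st sd [t [tP hsum]]]]].
  have [|||z zK hz] := @stable_set_center R 0 _ _ stR.
  - by rewrite -cardfs_gt0 ltnW.
  - by [].
  - by move=> x y xR yR; apply: vge_le dR (vge_depth _ xR yR).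
  exists (- z); first by rewrite rpredN.
  apply: (@integral_shift z (fun => 0)) => // [r rR|]; first by rewrite hz.
  by rewrite big1_eq addr0 vn ler0z.
have sR := cluster_sub sc; have [s0 _] := sc.
have [ts [z zK [zt zs]]] : {subset t <= s} /\ exists2 z, z \in K &
    (forall r, r \in t -> vge v (r - z) 0) /\
    (forall r, r \in s -> vge v (r - z) (depth v s)).
  (* A centre integrally close to [t] also serves for [s], because the depth of [s] is at most 0.
     For a singleton [t] the distances are all zero. *)
  case: tP => [->|[[tc tps _] tst t1]].
    split=> //; have [|z zK hz] := @stable_set_center s (depth v s) s0 sR st.
      by move=> x y; apply: vge_depth.
    by exists z.
  have ts : {subset t <= s} by apply/fsubsetP/fproper_sub.
  split=> //; have [t0 _] := tc; have tR := cluster_sub tc.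
  have [|z zK hz] := @stable_set_center t 0 t0 tR tst.
    move=> x y xt yt; case: t1 => [t1|dt]; last by apply: vge_le dt (vge_depth _ xt yt).
    have [->|xy] := eqVneq x y; first by rewrite subrr vge0.
    by have := proper_of_neq xt yt xy; rewrite /Defs.proper t1.
  exists z => //; split=> // r rs; have /fset0Pn[r' r't] := t0.
  have -> : r - z = (r - r') + (r' - z) by rewrite addrA subrK.
  apply: vgeD => //; first by apply: vge_depth => //; apply: ts.
  exact: vge_le sd (hz _ r't).
pose W r := depth v (wedge v R r s).
exists (- z); first by rewrite rpredN.
apply: (@integral_shift z
  (fun r => if r \in t then 0 else if r \in s then depth v s else W r)) => //.
  move=> r rR; case: ifPn => rt; first by rewrite lexx zt.
  case: ifPn => rs; first by rewrite sd zs.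
  have [wc rw sw _] := wedgeP hv sc rR rs.
  have Ws : W r <= depth v s.
    by apply: le_depth => // x y xs ys; apply: vge_depth; apply: sw.
  split; first exact: le_trans Ws sd.
  have /fset0Pn[r' r's] := s0.
  have -> : r - z = (r - r') + (r' - z) by rewrite addrA subrK.
  apply: vgeD => //; first by apply: vge_depth => //; apply: sw.
  exact: vge_le Ws (zs _ r's).
by rewrite (cluster_sum _ _ ts sR) vn addrA.
Qed.

End Integrality.

Theorem theorem13p3 (L : closedFieldType) (K : {pred L}) (v : L -> rat)
  (f : {poly L}) (g : nat) (R : {fset L}) :
  local_field_setting K v ->
  (2 <= g)%N ->
  (size f = (2 * g + 2)%N \/ size f = (2 * g + 3)%N) ->
  separable_poly f ->
  f \is a polyOver K ->
  (forall x, (x \in R) = root f x) ->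
  (f \is a polyOver (OK K v) ->
     exists n : int, v (lead_coef f) = n%:~R /\ integral K v R n) /\
  ((exists n : int, v (lead_coef f) = n%:~R /\ integral K v R n) ->
     tame_on_R K v R ->
     exists2 z, z \in K & f \Po ('X - z%:P) \is a polyOver (OK K v)).
Proof.
move=> [hK hA hv [_ hd] [hc hr _]] g2 sf fs fK fR.
have Rp : (1 < #|` R|)%N.
  by have := card_roots fs fR; case: sf => -> ; lia.
split=> [fO|[n [vn hn]] tame].
  have f0 := separable_poly_neq0 fs.
  have lK : lead_coef f \in K.
    by apply: (allP fK); rewrite lead_coefE mem_nth// prednK// size_poly_gt0.
  have [|n vn] := hd _ lK; first by rewrite lead_coef_eq0.
  by exists n; split=> //; apply: (integral_of_OK hK hA hv hc fK fs fR).
exact: (OK_of_integral hK hA hv hc fK fs fR hr tame vn Rp hn).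
Qed.
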